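(* Let $H\in\mathbb{R}^{n\times n}$ be symmetric with $H\succ 0$, let $A\in\mathbb{R}^{m\times n}$ have rows $A_1,\dots,A_m$ with $\|A_i\|_{H^{-1}}=1$ for all $i$, and let $P=\{x\in\mathbb{R}^n\mid Ax>\mathbf{0}\}$ be nonempty. Let $\beta>0$ be an arbitrary constant. Then in time $\tilde{O}(mn^\omega)$ we can run a MWU phase, which either finds $x\in P$ or gives $\lambda\in\mathbb{R}^m_{\ge 0}$ with $\|\lambda\|_1=1$ and $\|\lambda A\|_{H^{-1}}\le\frac{\beta}{n}$.
   Context: For a symmetric positive definite matrix $H$, $\|x\|_H=\sqrt{x^THx}$; $\|\cdot\|_{H^{-1}}$ is the analogous norm for $H^{-1}$. $\lambda A=\sum_{i=1}^m\lambda_iA_i$, and $Ax>\mathbf{0}$ is meant coordinatewise. $\omega\approx 2.373$ is the exponent of matrix multiplication, time is the number of elementary operations on real numbers, and $\tilde O(\cdot)$ suppresses factors polylogarithmic in $m$ and $n$ (the implied constants may depend on $\beta$). A multiplicative weights update (MWU) phase starts at $x=\mathbf{0}$ and repeatedly replaces the current point $x$ by $x+\varepsilon p$ for a suitably chosen direction $p$ and step size $\varepsilon>0$, using the potential $\Phi(x)=\sum_{i=1}^m e^{-\langle A_i,x\rangle}$ and the weights $\lambda_i=\frac{1}{\Phi(x)}e^{-\langle A_i,x\rangle}$; it stops when $\Phi(x)<1$ (in which case $x\in P$) or when $\|\lambda A\|_{H^{-1}}\le\frac{\beta}{n}$. *)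

(* Defs.v *)
From mathcomp Require Import all_boot all_order all_algebra.
From mathcomp Require Import all_classical all_reals all_analysis.

Set Implicit Arguments.
Unset Strict Implicit.
Unset Printing Implicit Defensive.

Import Order.TTheory GRing.Theory Num.Theory.

Local Open Scope classical_set_scope.
Local Open Scope ring_scope.

(** Running time is the number of elementary operations on real numbers.
    Algorithms are algebraic computation trees.  The memory is the sequence of
    all reals known so far, the input first; each operation appends its result
    and refers to its operands by position (a position outside the memory
    reads as 0).  [Div] is MathComp's total division, so x / 0 = 0.
    A tree is finite syntax that sees the input only through operations and
    comparisons; its leaves return a value of type [O] made of positions.
    One tree is used for each problem size, as in the usual definition of the
    exponent of matrix multiplication. *)

Inductive operation (R : Type) : Type :=
| Const of R
| Add of nat & nat
| Sub of nat & nat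
| Mul of nat & nat
| Div of nat & nat
| Exp of nat.

Inductive ctree (R O : Type) : Type :=
| Return of O
| Compute of operation R & ctree R O
| IfLe of nat & nat & ctree R O & ctree R O.

Section Execution.
Variables (R : realType) (O : Type).
Implicit Types (mem : seq R) (t : ctree R O).

Definition op_value mem (o : operation R) : R :=
  match o with
  | Const c => c
  | Add i j => mem`_i + mem`_j
  | Sub i j => mem`_i - mem`_j
  | Mul i j => mem`_i * mem`_j
  | Div i j => mem`_i / mem`_j
  | Exp i => expR mem`_i
  end.

Fixpoint exec t mem : O * seq R :=
  match t with
  | Return a => (a, mem)
  | Compute o t' => exec t' (rcons mem (op_value mem o))
  | IfLe i j t1 t2 => if mem`_i <= mem`_j then exec t1 mem else exec t2 mem
  end.

Fixpoint time t mem : nat :=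
  match t with
  | Return _ => 0
  | Compute o t' => (time t' (rcons mem (op_value mem o))).+1
  | IfLe i j t1 t2 =>
      (if mem`_i <= mem`_j then time t1 mem else time t2 mem).+1
  end.

End Execution.

(* Row-major list of entries, used to lay a matrix out in the input. *)
Definition mx_entries (R : Type) (m n : nat) (M : 'M[R]_(m, n)) : seq R :=
  [seq M i j | i <- enum 'I_m, j <- enum 'I_n].

(* Two n x n real matrices can be multiplied in time O~(n^omega).  A bound
   O(n^omega) is the case k = 0. *)
Definition matmul_exponent (R : realType) (omega : R) : Prop :=
  exists (C : R) (k : nat), forall n : nat, (0 < n)%N ->
  exists t : ctree R 'M[nat]_n, forall X Y : 'M[R]_n,
    let input := mx_entries X ++ mx_entries Y in
    let: (pos, mem) := exec t input in
    map_mx (nth 0 mem) pos = X *m Y /\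
    (time t input)%:R <= C * n%:R `^ omega * (1 + ln n%:R) ^+ k.

Definition posdefmx (R : realType) (n : nat) (H : 'M[R]_n) : Prop :=
  H^T = H /\ forall x : 'cV[R]_n, x != 0 -> 0 < (x^T *m H *m x) 0 0.

(* Stated on row vectors, as it is applied to rows of A and to lambda A. *)
Definition normH (R : realType) (n : nat) (H : 'M[R]_n) (v : 'rV[R]_n) : R :=
  Num.sqrt ((v *m H *m v^T) 0 0).

Definition cone (R : realType) (m n : nat) (A : 'M[R]_(m, n)) :
    set 'cV[R]_n :=
  [set x | forall i, 0 < (A *m x) i 0].

Definition potential (R : realType) (m n : nat) (A : 'M[R]_(m, n))
    (x : 'cV[R]_n) : R :=
  \sum_(i < m) expR (- (A *m x) i 0).

Definition weights (R : realType) (m n : nat) (A : 'M[R]_(m, n))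
    (x : 'cV[R]_n) : 'rV[R]_m :=
  \row_(i < m) ((potential A x)^-1 * expR (- (A *m x) i 0)).

Inductive answer (V : Type) (m n : nat) : Type :=
| Feasible of 'cV[V]_n
| Certificate of 'rV[V]_m.

(* Everything computed during a phase of [steps] updates.  The components are
   meaningful for t <= steps (iterate, phi, lambda) or t < steps (stepsize,
   dir).
   [V] is [nat] when a tree returns positions, and [R] for the actual values. *)
Record phase (V : Type) (m n : nat) : Type := Phase {
  steps : nat;
  iterate : nat -> 'cV[V]_n;
  phi : nat -> V;
  lambda : nat -> 'rV[V]_m;
  stepsize : nat -> V;
  dir : nat -> 'cV[V]_n;
  result : answer V m n
}.

Definition map_answer (V W : Type) (m n : nat) (f : V -> W)
    (a : answer V m n) : answer W m n :=
  match a with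
  | Feasible x => Feasible _ (map_mx f x)
  | Certificate l => Certificate _ (map_mx f l)
  end.

Definition map_phase (V W : Type) (m n : nat) (f : V -> W)
    (p : phase V m n) : phase W m n :=
  Phase (steps p)
        (fun t => map_mx f (iterate p t)) (fun t => f (phi p t))
        (fun t => map_mx f (lambda p t)) (fun t => f (stepsize p t))
        (fun t => map_mx f (dir p t)) (map_answer f (result p)).

Definition is_mwu_phase (R : realType) (m n : nat) (H : 'M[R]_n)
    (A : 'M[R]_(m, n)) (beta : R) (p : phase R m n) : Prop :=
  let small l := normH (invmx H) (l *m A) <= beta / n%:R in
  [/\ iterate p 0%N = 0,
      forall t, (t <= steps p)%N ->
        phi p t = potential A (iterate p t) /\
        lambda p t = weights A (iterate p t),
      forall t, (t < steps p)%N ->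
        [/\ 1 <= phi p t, ~ small (lambda p t), 0 < stepsize p t &
            iterate p t.+1 = iterate p t + stepsize p t *: dir p t] &
      match result p with
      | Feasible x => x = iterate p (steps p) /\ phi p (steps p) < 1
      | Certificate l => l = lambda p (steps p) /\ small l
      end].

(* Main.v *)
(* A single update from the origin to a point x is a legal MWU phase as soon as
   Phi(x) < 1 or the weights at x form a small combination, so it suffices to
   find such an x.  The function f = ln Phi is convex and O(1)-smooth in the
   norm of H, and its gradient there has norm |lambda A|_{H^-1}.  Plain
   descent needs O~(n^2) steps; Nesterov's accelerated method, applied to f plus
   a quadratic of strength delta ~ (beta / (n ln m))^2, needs only O~(n).  If
   after these steps neither the final x nor the gradient step u taken from it
   has Phi < 1, then f >= 0 at both points.  Comparing with the origin bounds
   delta |x|^2 by 2 ln m, comparing with u bounds the gradient of the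
   regularized function, and together they make the gradient of f at x at most
   beta / n.

   A step costs O(mn), so all steps cost O~(m n^2).  This is O~(m n^omega): an
   n x n product has n^2 entries that have to be computed.  The inverse of H is
   obtained within O~(n^omega) by recursion on Schur complements. *)

Require Import Defs.
From mathcomp Require Import all_boot all_order all_algebra.
From mathcomp Require Import all_classical all_reals all_analysis.
From mathcomp Require Import ring lra zify.

Set Implicit Arguments.
Unset Strict Implicit.
Unset Printing Implicit Defensive.

Import Order.TTheory GRing.Theory Num.Theory.

Local Open Scope classical_set_scope.
Local Open Scope ring_scope.

(** * Programs *)

(* A program receives the current size of the memory, hence the position of the
   next result. *)
Definition prog (R : Type) (O : Type) := nat -> ctree R O.

(** [s] follows the memory size along each branch, so that at a leaf [k] is told where its own
    results will land. *)
Fixpoint tbind (R O O' : Type) (t : ctree R O) (s : nat)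
    (k : O -> prog R O') : ctree R O' :=
  match t with
  | Return a => k a s
  | Compute o t' => Compute o (tbind t' s.+1 k)
  | IfLe i j t1 t2 => IfLe i j (tbind t1 s k) (tbind t2 s k)
  end.

Definition pret (R O : Type) (a : O) : prog R O := fun _ => Return R a.

Definition pbind (R O O' : Type) (p : prog R O) (k : O -> prog R O') :
  prog R O' := fun s => tbind (p s) s k.

Definition pop (R : Type) (o : operation R) : prog R nat :=
  fun s => Compute o (Return R s).

Definition pif (R O : Type) (i j : nat) (p q : prog R O) : prog R O :=
  fun s => IfLe i j (p s) (q s).

(* Quantifying over all extensions makes the assertion stable under further
   computation; in particular it forces [i < size mem]. *)
Definition holds (R : realType) (mem : seq R) (i : nat) (v : R) : Prop :=
  forall ext, (mem ++ ext)`_i = v.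

Definition holdsmx (R : realType) (m n : nat) (mem : seq R)
    (P : 'M[nat]_(m, n)) (M : 'M[R]_(m, n)) : Prop :=
  forall i j, holds mem (P i j) (M i j).

(** A total-correctness triple with a time bound. The final memory must extend the initial one, so
    facts about old positions survive and triples chain. *)
Definition spec (R : realType) (O : Type) (p : prog R O) (mem : seq R)
    (Q : O -> seq R -> Prop) (c : nat) : Prop :=
  exists ext a,
    [/\ exec (p (size mem)) mem = (a, mem ++ ext), Q a (mem ++ ext) &
        (time (p (size mem)) mem <= c)%N].

Lemma holds_cat (R : realType) (mem ext : seq R) i v :
  holds mem i v -> holds (mem ++ ext) i v.
Proof. by move=> h e; rewrite -catA. Qed.

Lemma holdsmx_cat (R : realType) (m n : nat) (mem ext : seq R)
    (P : 'M[nat]_(m, n)) (M : 'M[R]_(m, n)) :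
  holdsmx mem P M -> holdsmx (mem ++ ext) P M.
Proof. by move=> h i j; apply: holds_cat. Qed.

Lemma holds_nth (R : realType) (mem : seq R) i v : holds mem i v -> mem`_i = v.
Proof. by move=> /(_ [::]); rewrite cats0. Qed.

(** If [i] lay outside the memory, a long enough extension by copies of [v + 1] would put that value
    at [i]. *)
Lemma holds_lt (R : realType) (mem : seq R) i v :
  holds mem i v -> (i < size mem)%N.
Proof.
move=> h; rewrite ltnNge; apply/negP => le_i.
have := h (nseq (i - size mem).+1 (v + 1)).
rewrite nth_cat ltnNge le_i nth_nseq ltnSn => /eqP.
by rewrite -subr_eq0 addrC addKr oner_eq0.
Qed.

Lemma exec_tbind (R : realType) (O O' : Type) (t : ctree R O)
    (k : O -> prog R O') (mem : seq R) :
  exec (tbind t (size mem) k) mem =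
    let: (a, mem') := exec t mem in exec (k a (size mem')) mem'.
Proof.
elim: t mem => [a|o t IH|i j t1 IH1 t2 IH2] mem //=.
  by rewrite -IH size_rcons.
by case: ifP.
Qed.

Lemma time_tbind (R : realType) (O O' : Type) (t : ctree R O)
    (k : O -> prog R O') (mem : seq R) :
  time (tbind t (size mem) k) mem =
    (time t mem +
     let: (a, mem') := exec t mem in time (k a (size mem')) mem')%N.
Proof.
elim: t mem => [a|o t IH|i j t1 IH1 t2 IH2] mem //=.
  by rewrite addSn -IH size_rcons.
by case: ifP => _; rewrite ?IH1 ?IH2 addSn.
Qed.

Lemma spec_ret (R : realType) (O : Type) (a : O) (mem : seq R)
    (Q : O -> seq R -> Prop) c :
  Q a mem -> spec (pret R a) mem Q c.
Proof. by move=> q; exists [::], a; rewrite cats0. Qed.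

Lemma spec_bind (R : realType) (O O' : Type) (p : prog R O)
    (k : O -> prog R O') (mem : seq R) Q Q' c1 c2 :
  spec p mem Q c1 ->
  (forall a ext, Q a (mem ++ ext) -> spec (k a) (mem ++ ext) Q' c2) ->
  spec (pbind p k) mem Q' (c1 + c2).
Proof.
move=> [ext [a [ep qa tp]]] /(_ a ext qa) [ext' [b [ek qb tk]]].
exists (ext ++ ext'), b; rewrite /pbind exec_tbind time_tbind ep.
by rewrite catA; split => //; apply: leq_add.
Qed.

Lemma spec_weaken (R : realType) (O : Type) (p : prog R O) (mem : seq R)
    (Q Q' : O -> seq R -> Prop) c c' :
  spec p mem Q c -> (forall a ext, Q a (mem ++ ext) -> Q' a (mem ++ ext)) ->
  (c <= c')%N -> spec p mem Q' c'.
Proof.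
move=> [ext [a [ep qa tp]]] h lec; exists ext, a; split => //; first exact: h.
exact: leq_trans lec.
Qed.

Lemma spec_cost (R : realType) (O : Type) (p : prog R O) (mem : seq R) Q c c' :
  spec p mem Q c -> (c <= c')%N -> spec p mem Q c'.
Proof. by move=> h; apply: spec_weaken h _. Qed.

Lemma spec_pop (R : realType) (o : operation R) (mem : seq R) :
  spec (pop o) mem (fun i mem' => holds mem' i (op_value mem o)) 1.
Proof.
exists [:: op_value mem o], (size mem); rewrite /= -cats1; split => // ext.
by rewrite -catA nth_cat ltnn subnn.
Qed.

Lemma spec_pif (R : realType) (O : Type) (i j : nat) (p q : prog R O)
    (mem : seq R) Q c (vi vj : R) :
  holds mem i vi -> holds mem j vj ->
  (vi <= vj -> spec p mem Q c) -> (vj < vi -> spec q mem Q c) ->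
  spec (pif i j p q) mem Q c.+1.
Proof.
move=> /holds_nth hi /holds_nth hj hp hq; rewrite /spec /pif /= hi hj.
case: (lerP vi vj) => [/hp|/hq] [ext [a [e qa t]]]; exists ext, a;
  by split.
Qed.

(** * Straight-line expressions *)

Inductive expr (R : Type) : Type :=
| EVar of nat
| EConst of R
| EAdd of expr R & expr R
| ESub of expr R & expr R
| EMul of expr R & expr R
| EDiv of expr R & expr R
| EExp of expr R.

Arguments EVar {R}.

Fixpoint esize (R : Type) (e : expr R) : nat :=
  match e with
  | EVar _ => 0
  | EConst _ => 1
  | EAdd a b | ESub a b | EMul a b | EDiv a b => (esize a + (esize b + 1))%N
  | EExp a => (esize a + 1)%N
  end.

Definition pbinop (R : Type) (f : nat -> nat -> operation R)
    (p q : prog R nat) : prog R nat :=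
  pbind p (fun i => pbind q (fun j => pop (f i j))).

Fixpoint compile (R : Type) (e : expr R) : prog R nat :=
  match e with
  | EVar i => pret R i
  | EConst c => pop (Const c)
  | EAdd a b => pbinop (@Defs.Add R) (compile a) (compile b)
  | ESub a b => pbinop (@Defs.Sub R) (compile a) (compile b)
  | EMul a b => pbinop (@Defs.Mul R) (compile a) (compile b)
  | EDiv a b => pbinop (@Defs.Div R) (compile a) (compile b)
  | EExp a => pbind (compile a) (fun i => pop (@Exp R i))
  end.

Inductive evalsto (R : realType) (mem : seq R) : expr R -> R -> Prop :=
| evalsto_var i v : holds mem i v -> evalsto mem (EVar i) v
| evalsto_const c : evalsto mem (EConst c) c
| evalsto_add a b u v :
    evalsto mem a u -> evalsto mem b v -> evalsto mem (EAdd a b) (u + v)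
| evalsto_sub a b u v :
    evalsto mem a u -> evalsto mem b v -> evalsto mem (ESub a b) (u - v)
| evalsto_mul a b u v :
    evalsto mem a u -> evalsto mem b v -> evalsto mem (EMul a b) (u * v)
| evalsto_div a b u v :
    evalsto mem a u -> evalsto mem b v -> evalsto mem (EDiv a b) (u / v)
| evalsto_exp a u : evalsto mem a u -> evalsto mem (EExp a) (expR u).

Lemma evalsto_cat (R : realType) (mem ext : seq R) e v :
  evalsto mem e v -> evalsto (mem ++ ext) e v.
Proof.
by elim=> *; constructor=> //; apply: holds_cat.
Qed.

Lemma spec_binop (R : realType) (f : nat -> nat -> operation R)
    (g : R -> R -> R) (p q : prog R nat) (mem : seq R) (u v : R) cp cq :
  (forall mem i j, op_value mem (f i j) = g mem`_i mem`_j) ->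
  spec p mem (fun i mem' => holds mem' i u) cp ->
  (forall ext, spec q (mem ++ ext) (fun i mem' => holds mem' i v) cq) ->
  spec (pbinop f p q) mem
    (fun i mem' => holds mem' i (g u v)) (cp + (cq + 1)).
Proof.
move=> fg hp hq; apply: spec_bind hp _ => i ext hi.
apply: spec_bind (hq ext) _ => j ext' hj.
apply: spec_weaken (spec_pop _ _) _ _ => // k ext''.
by rewrite fg (holds_nth hj) (holds_nth (holds_cat ext' hi)).
Qed.

Lemma spec_compile (R : realType) (e : expr R) (mem : seq R) (v : R) :
  evalsto mem e v ->
  spec (compile e) mem (fun i mem' => holds mem' i v) (esize e).
Proof.
move=> ev.
(* The second operand runs in a memory already extended by the first, so the induction has to cover
   all extensions. *)
suff: forall ext, spec (compile e) (mem ++ ext)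
    (fun i mem' => holds mem' i v) (esize e).
  by move/(_ [::]); rewrite cats0.
elim: ev => {e v} /=.
- by move=> i v h ext; apply: spec_ret; apply: holds_cat.
- by move=> c ext; apply: spec_pop.
- by move=> a b u v _ ha _ hb ext; apply: (@spec_binop _ _ +%R) => // e;
    rewrite -catA.
- move=> a b u v _ ha _ hb ext.
  by apply: (@spec_binop _ _ (fun x y => x - y)) => // e; rewrite -catA.
- by move=> a b u v _ ha _ hb ext; apply: (@spec_binop _ _ *%R) => // e;
    rewrite -catA.
- move=> a b u v _ ha _ hb ext.
  by apply: (@spec_binop _ _ (fun x y => x / y)) => // e; rewrite -catA.
- move=> a u _ ha ext; apply: spec_bind (ha ext) _ => i ext' hi.
  apply: spec_weaken (spec_pop _ _) _ _ => // k ext''.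
  by rewrite /= (holds_nth hi).
Qed.

Definition sum_expr (R : realType) (n : nat) (e : 'I_n -> expr R) : expr R :=
  foldr (fun i acc => EAdd (e i) acc) (@EConst R 0) (enum 'I_n).

Lemma evalsto_sum (R : realType) (mem : seq R) (n : nat)
    (e : 'I_n -> expr R) (v : 'I_n -> R) :
  (forall i, evalsto mem (e i) (v i)) ->
  evalsto mem (sum_expr e) (\sum_(i < n) v i).
Proof.
move=> h; rewrite /sum_expr -big_enum; elim: (enum _) => [|i s IH] /=.
  by rewrite big_nil; constructor.
by rewrite big_cons; constructor.
Qed.

Lemma esize_sum (R : realType) (n : nat) (e : 'I_n -> expr R) c :
  (forall i, (esize (e i) <= c)%N) -> (esize (sum_expr e) <= n * c.+1 + 1)%N.
Proof.
move=> h; rewrite /sum_expr -[X in (_ <= X * _ + _)%N](size_enum_ord n).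
elim: (enum _) => [|i s IH] //=; rewrite mulSn.
by apply: leq_trans (leq_add (h i) (leq_add IH (leqnn 1))) _;
  rewrite !addn1 !addSn !addnS.
Qed.

Fixpoint traverse (R : Type) (T : eqType) (s : seq T) (f : T -> prog R nat) :
    prog R (T -> nat) :=
  match s with
  | [::] => pret R (fun _ => 0%N)
  | x :: s' =>
      pbind (f x) (fun i => pbind (traverse s' f)
        (fun r => pret R (fun y => if y == x then i else r y)))
  end.

Lemma spec_traverse (R : realType) (T : eqType) (s : seq T)
    (f : T -> prog R nat) (v : T -> R) (mem : seq R) c :
  (forall x ext,
     spec (f x) (mem ++ ext) (fun i mem' => holds mem' i (v x)) c) ->
  spec (traverse s f) mem
    (fun r mem' => forall x, x \in s -> holds mem' (r x) (v x)) (size s * c).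
Proof.
move=> h; suff: forall ext, spec (traverse s f) (mem ++ ext)
    (fun r mem' => forall x, x \in s -> holds mem' (r x) (v x)) (size s * c).
  by move/(_ [::]); rewrite cats0.
elim: s => [|x s IH] ext /=; first exact: spec_ret.
rewrite mulSn; apply: spec_bind (h x ext) _ => i ext1 hi.
rewrite -[X in spec _ _ _ X]addn0 -catA; apply: spec_bind (IH _) _ => r ext2 hr.
apply: spec_ret => y; rewrite inE; case: eqP => [-> _|_ /=]; last exact: hr.
by have := holds_cat ext2 hi; rewrite catA.
Qed.

Definition pmx (R : realType) (m n : nat) (e : 'I_m -> 'I_n -> expr R) :
    prog R 'M[nat]_(m, n) :=
  pbind (traverse (enum (('I_m * 'I_n)%type : finType)) (fun ij =>
    compile (e ij.1 ij.2)))
        (fun r => pret R (\matrix_(i, j) r (i, j))).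

Lemma spec_pmx (R : realType) (m n : nat) (e : 'I_m -> 'I_n -> expr R)
    (M : 'M[R]_(m, n)) (mem : seq R) c :
  (forall i j, evalsto mem (e i j) (M i j)) ->
  (forall i j, (esize (e i j) <= c)%N) ->
  spec (pmx e) mem (fun P mem' => holdsmx mem' P M) (m * n * c).
Proof.
move=> he hc; rewrite -[X in spec _ _ _ X]addn0.
have sz : size (enum (('I_m * 'I_n)%type : finType)) = (m * n)%N.
  by rewrite -cardE card_prod !card_ord.
rewrite -sz; apply: spec_bind.
  apply: (@spec_traverse _ _ _ _ (fun ij => M ij.1 ij.2)) => x ext.
  by apply: spec_weaken (spec_compile (evalsto_cat ext (he _ _))) _ (hc _ _).
move=> r ext hr; apply: spec_ret => i j; rewrite mxE.
by apply: (hr (i, j)); rewrite mem_enum.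
Qed.

(** * Relocating a tree *)

Definition op_rename (R : Type) (f : nat -> nat) (o : operation R) :
    operation R :=
  match o with
  | Const c => Const c
  | Add i j => Add R (f i) (f j)
  | Defs.Sub i j => Defs.Sub R (f i) (f j)
  | Mul i j => Mul R (f i) (f j)
  | Div i j => Div R (f i) (f j)
  | Exp i => Exp R (f i)
  end.

Fixpoint rename (R O : Type) (f : nat -> nat) (t : ctree R O) : ctree R O :=
  match t with
  | Return a => Return R a
  | Compute o t' => Compute (op_rename f o) (rename f t')
  | IfLe i j t1 t2 => IfLe (f i) (f j) (rename f t1) (rename f t2)
  end.

(* A tree written for the input [inp] runs in memory [mem] once its reads of
   input position [i] are redirected to [l`_i]. *)
Lemma exec_rename (R : realType) (O : Type) (l : seq nat) (s : nat)
    (t : ctree R O) (inp mem : seq R) :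
  let f i := if (i < size l)%N then nth 0%N l i else (s + (i - size l))%N in
  (forall i, (i < size l)%N -> (nth 0%N l i < s)%N) ->
  (size l <= size inp)%N -> size mem = (s + (size inp - size l))%N ->
  (forall i, mem`_(f i) = inp`_i) ->
  [/\ (exec (rename f t) mem).1 = (exec t inp).1,
      time (rename f t) mem = time t inp,
      size (exec (rename f t) mem).2 =
        (s + (size (exec t inp).2 - size l))%N /\
      (size l <= size (exec t inp).2)%N,
      forall i, (exec (rename f t) mem).2`_(f i) = (exec t inp).2`_i &
      exists ext, (exec (rename f t) mem).2 = mem ++ ext].
Proof.
move=> f hl; elim: t inp mem =>
  [a|o t IH|i j t1 IH1 t2 IH2] inp mem /= le_l sz hf.
- by split => //; exists [::]; rewrite cats0.
- have -> : op_value mem (op_rename f o) = op_value inp o.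
    by case: o => [c|i j|i j|i j|i j|i] /=; rewrite ?hf.
  set w := op_value inp o.
  have := IH (rcons inp w) (rcons mem w).
  rewrite !size_rcons => /(_ (leqW le_l)) [||-> -> h3 h4 [ext h5]].
  + by rewrite sz subSn // addnS.
  + move=> i; rewrite !nth_rcons sz.
    (* [f] sends old positions to old ones, and the next free position, alone, to the next free one;
       hence appending [w] on both sides keeps the two memories in step. *)
    have -> : (f i < s + (size inp - size l))%N = (i < size inp)%N.
      rewrite /f; case: ifP => [lt_il|/negbT]; last lia.
      by move: (hl _ lt_il); lia.
    have -> : (f i == s + (size inp - size l))%N = (i == size inp).
      rewrite /f; case: ifP => [lt_il|/negbT]; last lia.
      by move: (hl _ lt_il); lia.
    by rewrite hf.
  split => //; exists (w :: ext); by rewrite h5 cat_rcons.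
- rewrite !hf; case: ifP => _.
    by have [-> -> ? ? ?] := IH1 _ _ le_l sz hf.
  by have [-> -> ? ? ?] := IH2 _ _ le_l sz hf.
Qed.

Lemma nth_allpairs (S T U : Type) (f : S -> T -> U) (s : seq S) (t : seq T)
    (x0 : S) (y0 : T) (z0 : U) (i j : nat) :
  (i < size s)%N -> (j < size t)%N ->
  nth z0 [seq f x y | x <- s, y <- t] (i * size t + j) =
    f (nth x0 s i) (nth y0 t j).
Proof.
elim: s i => [|x s IH] [|i] //=.
  by move=> _ lt_j; rewrite add0n nth_cat size_map lt_j (nth_map y0).
rewrite ltnS => lt_i lt_j; rewrite mulSn -addnA nth_cat size_map.
by rewrite ltnNge leq_addr addKn IH.
Qed.

(** * Matrices in memory and relocated multiplication trees *)

Lemma size_mx_entries (T : Type) (m n : nat) (M : 'M[T]_(m, n)) :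
  size (mx_entries M) = (m * n)%N.
Proof. by rewrite size_allpairs !size_enum_ord. Qed.

Lemma ltn_mx_pos (m n : nat) (i : 'I_m) (j : 'I_n) : (i * n + j < m * n)%N.
Proof.
apply: (@leq_trans (i.+1 * n)); last by rewrite leq_mul2r ltn_ord orbT.
by rewrite mulSn addnC ltn_add2r.
Qed.

Lemma nth_mx_entries (T : Type) (m n : nat) (x0 : T) (M : 'M[T]_(m, n))
    (i : 'I_m) (j : 'I_n) :
  nth x0 (mx_entries M) (i * n + j) = M i j.
Proof.
have := @nth_allpairs _ _ _ (fun i j =>
  M i j) (enum 'I_m) (enum 'I_n) i j x0 i j.
by rewrite !size_enum_ord !nth_ord_enum => ->.
Qed.

Lemma mx_entries_map (T U : Type) (f : T -> U) (m n : nat) (M : 'M[T]_(m, n)) :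
  mx_entries (map_mx f M) = map f (mx_entries M).
Proof.
rewrite /mx_entries map_allpairs; apply: eq_allpairs => // i j.
by rewrite mxE.
Qed.

Lemma holdsmx_map (R : realType) (m n : nat) (mem : seq R)
    (P : 'M[nat]_(m, n)) (M : 'M[R]_(m, n)) :
  holdsmx mem P M -> map_mx (nth 0 mem) P = M.
Proof. by move=> h; apply/matrixP => i j; rewrite mxE (holds_nth (h i j)). Qed.

Lemma all_mx_entries (T : eqType) (a : pred T) (m n : nat) (M : 'M[T]_(m, n)) :
  (forall i j, a (M i j)) -> all a (mx_entries M).
Proof. by move=> h; apply/allP => x /allpairsP[[i j] [_ _ ->]]. Qed.

Definition has_mul (R : realType) (n c : nat) : Prop :=
  exists p : 'M[nat]_n -> 'M[nat]_n -> prog R 'M[nat]_n,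
  forall mem P Q X Y, holdsmx mem P X -> holdsmx mem Q Y ->
  spec (p P Q) mem (fun W mem' => holdsmx mem' W (X *m Y)) c.

(* A tree may return positions outside the memory to denote 0; they are
   redirected to an explicit 0. *)
Lemma has_mul_tree (R : realType) (n c : nat) (t : ctree R 'M[nat]_n) :
  (forall X Y : 'M[R]_n,
    let input := mx_entries X ++ mx_entries Y in
    let: (pos, mem) := exec t input in
    map_mx (nth 0 mem) pos = X *m Y /\ (time t input <= c)%N) ->
  has_mul R n c.+1.
Proof.
move=> ht.
pose l (P Q : 'M[nat]_n) := mx_entries P ++ mx_entries Q.
pose f P Q s i := if (i < size (l P Q))%N then nth 0%N (l P Q) i
                  else (s + (i - size (l P Q)))%N.
exists (fun P Q s => tbind (rename (f P Q s) t) s (fun pos s' =>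
  Compute (Const 0) (Return R
    (map_mx (fun i => if (f P Q s i < s')%N then f P Q s i else s') pos)))).
move=> mem P Q X Y hP hQ.
have := ht X Y; set inp := _ ++ _.
have einp : map (nth 0 mem) (l P Q) = inp.
  by rewrite map_cat -!mx_entries_map (holdsmx_map hP) (holdsmx_map hQ).
have sinp : size (l P Q) = size inp by rewrite -einp size_map.
have [||||h1 h2 [h3 _] h4 [ext h5]] := @exec_rename _ _ (l P Q)
  (size mem) t inp mem.
- have : all (fun i => i < size mem)%N (l P Q).
    by rewrite all_cat !all_mx_entries // => i j;
      [apply: holds_lt (hQ i j) | apply: holds_lt (hP i j)].
  by move/all_nthP => h i; apply: h.
- by rewrite sinp.
- by rewrite sinp subnn addn0.
- move=> i; rewrite -einp; case: ifP => hi; first by rewrite (nth_map 0%N).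
  rewrite !nth_default // ?size_map leqNgt ?hi //.
  by rewrite -leqNgt leq_addr.
move: h1 h2 h3 h4 h5; rewrite -/(f P Q (size mem)).
case E: (exec t inp) => [pos inp'] /=.
case E' : (exec (rename _ t) mem) => [pos' mem'] /= h1 h2 h3 h4 h5.
rewrite E => -[hpos htime].
rewrite h1 in E'.
(* The 0 is stored explicitly because a position outside the memory reads 0 only until a later
   result occupies it, while [holds] asks for a lasting value. *)
exists (ext ++ [:: 0]); eexists; split.
- by rewrite exec_tbind E' /= -cats1 h5 catA.
- move=> i j ext'; rewrite mxE catA -h5 -hpos mxE -catA.
  case: ifP => [lt_f|/negbT]; first by rewrite nth_cat lt_f h4.
  rewrite -leqNgt => le_f; rewrite nth_cat ltnn subnn /= -h4 nth_default //.
- by rewrite time_tbind E' h2 /= addn1 ltnS.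
Qed.

(** * Inverting a positive definite matrix *)

Lemma posdefmx_unit (R : realType) (n : nat) (H : 'M[R]_n) :
  posdefmx H -> H \in unitmx.
Proof.
move=> [_ pos]; rewrite unitmxE unitfE; apply/det0P => -[v v0 vH].
have := pos v^T; rewrite trmxK vH mul0mx mxE ltxx.
suff -> : v^T != 0 by move/(_ isT).
by apply: contraNneq v0 => /(congr1 trmx); rewrite trmxK trmx0 => ->.
Qed.

Lemma mulmx1_invmx (R : realType) (n : nat) (H K : 'M[R]_n) :
  H *m K = 1%:M -> K = invmx H.
Proof.
move=> HK; have [uH _] := mulmx1_unit HK.
by rewrite -[K]mul1mx -(mulVmx uH) -mulmxA HK mulmx1.
Qed.

(** * Schur complement of a symmetric block matrix *)

Section Block.
Context (R : realType) (n : nat) (A B D : 'M[R]_n).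
Let H := block_mx A B B^T D.
Hypothesis posH : posdefmx H.
Let U := invmx A *m B.
Let S := D - B^T *m U.

Lemma posdefmx_ul : posdefmx A.
Proof.
case: posH => symH pos; split.
  by move: symH; rewrite /H tr_block_mx => /eq_block_mx[].
move=> x x0; have := pos (col_mx x 0).
rewrite col_mx_eq0 negb_and x0 /H tr_col_mx mul_row_block mul_row_col.
by rewrite trmx0 !mul0mx !addr0 mulmx0 addr0; apply.
Qed.

(** The form of [S] at x is the form of [H] at the vector with blocks - U x and x, which is nonzero
    when x is. *)
Lemma posdefmx_schur : posdefmx S.
Proof.
have [symA _] := posdefmx_ul; have uA := posdefmx_unit posdefmx_ul.
case: posH => symH pos.
have symD : D^T = D by move: symH; rewrite /H tr_block_mx => /eq_block_mx[].
split.
  rewrite /S /U linearB /= symD trmx_mul trmx_mul trmxK trmx_inv symA.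
  by rewrite mulmxA.
move=> x x0; have := pos (col_mx (- (U *m x)) x).
rewrite col_mx_eq0 negb_and x0 orbT => /(_ isT).
rewrite /H tr_col_mx mul_row_block mul_row_col.
congr (_ < fun_of_matrix _ _ _).
have AU : A *m U = B by rewrite /U mulmxA mulmxV // mul1mx.
set u := - (U *m x).
have Au : A *m u = - (B *m x) by rewrite mulmxN mulmxA AU.
rewrite !mulmxDl -!mulmxA Au addrACA -mulmxDr addNr mulmx0 add0r -mulmxDr.
by rewrite /S mulmxBl mulmxN addrC mulmxA.
Qed.

(** Block elimination, checked by multiplying out. Only [A] and [S], both of half the size, have to
    be inverted. *)
Lemma invmx_block :
  let S1 := invmx S in let W := U *m S1 in
  invmx H = block_mx (invmx A + W *m U^T) (- W) (- W^T) S1.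
Proof.
move=> S1 W; apply/esym/mulmx1_invmx.
have [symA _] := posdefmx_ul; have uA := posdefmx_unit posdefmx_ul.
have [symS _] := posdefmx_schur; have uS := posdefmx_unit posdefmx_schur.
have AU : A *m U = B by rewrite /U mulmxA mulmxV // mul1mx.
have WT : W^T = S1 *m U^T by rewrite trmx_mul trmx_inv symS.
have UT : U^T = B^T *m invmx A by rewrite trmx_mul trmx_inv symA.
have AW : A *m W = B *m S1 by rewrite mulmxA AU.
have DW : D *m S1 - B^T *m W = 1%:M.
  by rewrite mulmxA -mulmxBl mulmxV.
rewrite mulmx_block scalar_mx_block; congr block_mx.
- by rewrite mulmxDr mulmxV // mulmxA AW mulmxN WT mulmxA addrK.
- by rewrite mulmxN AW addNr.
- rewrite mulmxDr mulmxN WT -UT [_ *m (W *m _)]mulmxA [D *m _]mulmxA.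
  rewrite -addrA -mulmxBl.
  have -> : B^T *m W - D *m S1 = - 1%:M by rewrite -DW opprB.
  by rewrite mulNmx mul1mx subrr.
- by rewrite mulmxN addrC DW.
Qed.

End Block.

Lemma mxBE (V : zmodType) (m n : nat) (M N : 'M[V]_(m, n)) i j :
  (M - N) i j = M i j - N i j.
Proof. by rewrite !mxE. Qed.

Definition has_inv (R : realType) (n c : nat) : Prop :=
  exists p : 'M[nat]_n -> prog R 'M[nat]_n,
  forall mem P H, posdefmx H -> holdsmx mem P H ->
  spec (p P) mem (fun W mem' => holdsmx mem' W (invmx H)) c.

Lemma has_inv1 (R : realType) : has_inv R 1 2.
Proof.
exists (fun P => pmx (fun i j => EDiv (EConst 1) (EVar (P i j)))).
move=> mem P H posH hP; have uH := posdefmx_unit posH.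
apply: (@spec_pmx _ _ _ _ _ _ 2) => // i j.
have -> : invmx H = \matrix_(i, j) (1 / H i j).
  apply/esym/mulmx1_invmx/matrixP => k l; rewrite !mxE big_ord1 !mxE.
  rewrite !ord1 eqxx mulrA mulr1 divff //.
  by move: uH; rewrite unitmxE det_mx11 unitfE.
by rewrite mxE; constructor; constructor.
Qed.

Lemma holdsmx_block (R : realType) (n : nat) (mem : seq R)
    (P1 P2 P3 P4 : 'M[nat]_n) (M1 M2 M3 M4 : 'M[R]_n) :
  holdsmx mem P1 M1 -> holdsmx mem P2 M2 -> holdsmx mem P3 M3 ->
  holdsmx mem P4 M4 ->
  holdsmx mem (block_mx P1 P2 P3 P4) (block_mx M1 M2 M3 M4).
Proof.
by move=> h1 h2 h3 h4 i j; rewrite !mxE; case: (fintype.split i) => k;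
  rewrite !mxE;
  case: (fintype.split j) => l.
Qed.

Lemma holdsmx_tr (R : realType) (m n : nat) (mem : seq R)
    (P : 'M[nat]_(m, n)) (M : 'M[R]_(m, n)) :
  holdsmx mem P M -> holdsmx mem P^T M^T.
Proof. by move=> h i j; rewrite !mxE. Qed.

(** The formula of [invmx_block] takes two inversions, the four products [U], [V], [W], [Z], and
    entrywise work of 1 + 1 + 2 operations per entry of a block. Transposing is free, since it only
    permutes positions. *)
Lemma has_inv_double (R : realType) (n c d : nat) :
  has_mul R n d -> has_inv R n c ->
  has_inv R (n + n) (2 * c + 4 * d + 4 * (n * n)).
Proof.
move=> [mul hmul] [inv hinv].
exists (fun P =>
  pbind (inv (ulsubmx P)) (fun A1 =>
  pbind (mul A1 (ursubmx P)) (fun U =>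
  pbind (mul (dlsubmx P) U) (fun V =>
  pbind (pmx (fun i j => ESub (EVar (drsubmx P i j)) (EVar (V i j)))) (fun S =>
  pbind (inv S) (fun S1 =>
  pbind (mul U S1) (fun W =>
  pbind (mul W U^T) (fun Z =>
  pbind (pmx (fun i j => EAdd (EVar (A1 i j)) (EVar (Z i j)))) (fun K1 =>
  pbind (pmx (fun i j => ESub (EConst 0) (EVar (W i j)))) (fun K2 =>
  pret R (block_mx K1 K2 K2^T S1))))))))))).
move=> mem P H posH hP.
have [symH _] := posH.
have eH : H = block_mx (ulsubmx H) (ursubmx H) (ursubmx H)^T (drsubmx H).
  by rewrite trmx_ursub symH submxK.
have hul : holdsmx mem (ulsubmx P) (ulsubmx H) by move=> i j; rewrite !mxE.
have hur : holdsmx mem (ursubmx P) (ursubmx H) by move=> i j; rewrite !mxE.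
have hdl : holdsmx mem (dlsubmx P) (ursubmx H)^T.
  by move=> i j; rewrite trmx_ursub symH !mxE.
have hdr : holdsmx mem (drsubmx P) (drsubmx H) by move=> i j; rewrite !mxE.
move: eH hul hur hdl hdr; set A := ulsubmx H; set B := ursubmx H.
set D := drsubmx H => eH hul hur hdl hdr.
rewrite eH in posH *; rewrite (invmx_block posH) /=.
have posA := posdefmx_ul posH; have posS := posdefmx_schur posH.
apply: (@spec_cost _ _ _ _ _
  (c + (d + (d + (n * n * 1 + (c + (d + (d + (n * n * 1 + (n * n * 2 +
    0)))))))))); last lia.
apply: spec_bind (hinv _ _ _ posA hul) _ => A1 e1 hA1.
apply: spec_bind (hmul _ _ _ _ _ hA1 (holdsmx_cat _ hur)) _ => U e2 hU.
apply: spec_bind (hmul _ _ _ _ _ _ hU) _ => [|V e3 hV].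
  by do 2!apply: holdsmx_cat; exact: hdl.
apply: spec_bind.
  apply: (@spec_pmx _ _ _ _ (D - B^T *m (invmx A *m B)) _ 1) => // i j.
  rewrite mxBE; apply: evalsto_sub; apply: evalsto_var; last exact: hV.
  by do 3!apply: holds_cat; exact: hdr.
move=> S e4 hS.
apply: spec_bind (hinv _ _ _ posS hS) _ => S1 e5 hS1.
apply: spec_bind (hmul _ _ _ _ _ _ hS1) _ => [|W e6 hW].
  by do 3!apply: holdsmx_cat; exact: hU.
apply: spec_bind (hmul _ _ _ _ _ hW _) _ => [|Z e7 hZ].
  by do 4!apply: holdsmx_cat; apply: holdsmx_tr; exact: hU.
apply: spec_bind.
  apply: (@spec_pmx _ _ _ _ (invmx A +
    (invmx A *m B) *m invmx (D - B^T *m (invmx A *m B)) *m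
    (invmx A *m B)^T) _ 1) => // i j.
  rewrite mxE; apply: evalsto_add; apply: evalsto_var; last exact: hZ.
  by do 6!apply: holds_cat; exact: hA1.
move=> K1 e8 hK1.
apply: spec_bind.
  apply: (@spec_pmx _ _ _ _ (- ((invmx A *m B) *m invmx (D - B^T *m
    (invmx A *m B)))) _ 2) => // i j.
  rewrite mxE -sub0r; apply: evalsto_sub; first exact: evalsto_const.
  by apply: evalsto_var; do 2!apply: holds_cat; exact: hW.
move=> K2 e9 hK2; apply: spec_ret; apply: holdsmx_block => //.
- by apply: holdsmx_cat.
- by rewrite -linearN; apply: holdsmx_tr.
- by do 4!apply: holdsmx_cat.
Qed.

(** Bordering with an identity block preserves positive definiteness, and the wanted inverse is the
    upper left block. The 2 extra operations create the constants 0 and 1. *)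
Lemma has_inv_pad (R : realType) (n k D c : nat) :
  (n + k)%N = D -> has_inv R D c -> has_inv R n (c + 2).
Proof.
move=> <- {D} [inv hinv].
exists (fun P =>
  pbind (pop (Const 0)) (fun z => pbind (pop (Const 1)) (fun o =>
  pbind (inv (block_mx P (const_mx z) (const_mx z)
                (\matrix_(i, j) if i == j then o else z)))
    (fun W => pret R (ulsubmx W))))).
move=> mem P H posH hP.
apply: (@spec_cost _ _ _ _ _ (1 + (1 + (c + 0)))); last lia.
apply: spec_bind (spec_pop _ _) _ => z e1 hz.
apply: spec_bind (spec_pop _ _) _ => o e2 ho.
have {}hz := holds_cat e2 hz; have {}hP := holdsmx_cat e2 (holdsmx_cat e1 hP).
move: hP hz ho; set mem' := (mem ++ _) ++ _ => /= hP hz ho.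
have posH' : posdefmx (block_mx H 0 0 (1%:M : 'M[R]_k)).
  case: posH => symH pos; split.
    by rewrite tr_block_mx symH trmx1 !trmx0.
  move=> y; rewrite -[y]vsubmxK; move: (usubmx y) (dsubmx y) => u v.
  rewrite col_mx_eq0 tr_col_mx mul_row_block mul_row_col !mulmx0 addr0 add0r.
  rewrite mulmx1 mxE.
  have v_ge0 : 0 <= (v^T *m v) 0 0.
    by rewrite mxE sumr_ge0 // => i _; rewrite mxE -expr2 sqr_ge0.
  have [-> /=|/pos u_gt0 _] := eqVneq u 0; last by rewrite ltr_wpDr.
  rewrite mulmx0 mxE add0r lt_neqAle v_ge0 andbT; apply: contraNneq.
  rewrite mxE => /eqP; rewrite eq_sym psumr_eq0 => [/allP v0|i _]; last first.
    by rewrite mxE -expr2 sqr_ge0.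
  apply/eqP/matrixP => i j; have /implyP/(_ isT) := v0 i (mem_index_enum _).
  by rewrite !mxE ord1 mulf_eq0 orbb => /eqP.
apply: spec_bind.
  apply: hinv posH' _ => i j; rewrite !mxE; case: (fintype.split i) => a;
    rewrite !mxE;
    case: (fintype.split j) => b; rewrite ?mxE //.
  by case: eqP.
move=> W e3 hW; apply: spec_ret => i j.
have -> : invmx H = ulsubmx (invmx (block_mx H 0 0 (1%:M : 'M[R]_k))).
  have <- : block_mx (invmx H) 0 0 1%:M = invmx (block_mx H 0 0
    (1%:M : 'M[R]_k)).
    apply: mulmx1_invmx; rewrite mulmx_block !mulmx0 !mul0mx !addr0 !add0r
      mulmx1.
    by rewrite mulmxV ?posdefmx_unit // -scalar_mx_block.
  by rewrite block_mxKul.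
by rewrite !mxE; apply: hW.
Qed.

Lemma has_inv_pow2 (R : realType) (M : nat -> nat) (I : nat -> nat) :
  (forall n, (0 < n)%N -> has_mul R n (M n)) ->
  I 0%N = 2%N ->
  (forall q, I q.+1 = (2 * I q + 4 * M (2 ^ q) + 4 * (2 ^ q * 2 ^ q))%N) ->
  forall q, has_inv R (2 ^ q) (I q).
Proof.
move=> hM I0 IS; elim=> [|q IH]; first by rewrite I0; apply: has_inv1.
rewrite IS expnS mul2n -addnn; apply: has_inv_double => //.
by apply: hM; rewrite expn_gt0.
Qed.

(** * Cost of fast matrix multiplication *)

(** Each appended entry costs one unit, so a lower bound on the number of new reals becomes a lower
    bound on time. *)
Lemma exec_extends (R : realType) (O : Type) (t : ctree R O) (mem : seq R) :
  exists2 ext, (exec t mem).2 = mem ++ ext & (size ext <= time t mem)%N.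
Proof.
elim: t mem => [a|o t IH|i j t1 IH1 t2 IH2] mem /=.
- by exists [::]; rewrite ?cats0.
- have [ext -> le_ext] := IH (rcons mem (op_value mem o)).
  by exists (op_value mem o :: ext); rewrite // cat_rcons.
- case: ifP => _; [have [ext -> le_ext] := IH1 mem|
    have [ext -> le_ext] := IH2 mem]; exists ext => //; exact: leqW.
Qed.

(* For X = c I and Y with distinct entries the product has n^2 distinct
   nonzero entries, none of them an input, so each must be computed. *)
Lemma mul_tree_time (R : realType) (n : nat) (t : ctree R 'M[nat]_n) :
  (forall X Y : 'M[R]_n,
    let: (pos, mem) := exec t (mx_entries X ++ mx_entries Y) in
    map_mx (nth 0 mem) pos = X *m Y) ->
  exists X Y : 'M[R]_n,
    (n * n <= time t (mx_entries X ++ mx_entries Y))%N.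
Proof.
(* Entries of [Y] lie between 2 and c - 1, so every product entry is at least 2c: it exceeds 0 and
   every input entry. *)
move=> ht; pose c : R := (n * n + 2)%N%:R.
pose y (i j : 'I_n) := (2 + (i * n + j))%N.
have lt_y i j : (y i j < n * n + 2)%N.
  by rewrite /y addnC ltn_add2r ltn_mx_pos.
pose Y : 'M[R]_n := \matrix_(i, j) (y i j)%:R.
exists c%:M, Y; set inp := _ ++ _.
have := ht c%:M Y; rewrite -/inp.
have [ext] := exec_extends t inp; case: exec => pos mem /= emem le_ext eXY.
apply: leq_trans le_ext.
pose s := [seq c * Y p.1 p.2 | p <- enum (('I_n * 'I_n)%type : finType)].
have <- : size s = (n * n)%N by rewrite size_map -cardE card_prod !card_ord.
have c_gt0 : 0 < c by rewrite ltr0n addn2.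
apply: uniq_leq_size.
  rewrite map_inj_uniq ?enum_uniq // => -[i j] [i' j'] /=.
  move=> /(mulfI (lt0r_neq0 c_gt0)); rewrite !mxE => /eqP.
  rewrite eqr_nat !eqn_add2l => /eqP e.
  have n_gt0 : (0 < n)%N by apply: leq_ltn_trans (ltn_ord i).
  congr pair; apply: val_inj => /=.
    by have := congr1 (divn^~ n) e; rewrite !divnMDl // !divn_small // !addn0.
  by have := congr1 (modn^~ n) e; rewrite !modnMDl !modn_small.
move=> _ /mapP[[i j] _ ->] /=.
have e : mem`_(pos i j) = c * Y i j.
  by move/matrixP/(_ i j): eXY; rewrite mul_scalar_mx !mxE.
have lt2c : 2 * c <= c * Y i j.
  by rewrite mulrC ler_pM2l // mxE ler_nat /y; lia.
have : c * Y i j \in mem.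
  rewrite -e mem_nth // ltnNge; apply/negP => le_pos.
  by move: lt2c; rewrite -e nth_default // leNgt mulr_gt0.
rewrite emem !mem_cat => /orP[/orP[]|//].
- move=> /allpairsP[[a b] [_ _ /=]]; rewrite [in RHS]mxE => eab; move: lt2c;
    rewrite eab.
  by case: (a == b) => /=; rewrite ?mulr1n ?mulr0n => h; exfalso;
    move: c_gt0 h; clear; lra.
- move=> /allpairsP[[a b] [_ _ /=]]; rewrite [in RHS]mxE => eab; move: lt2c;
    rewrite eab.
  have : (y a b)%:R <= c :> R by rewrite ler_nat ltnW.
  by move=> h1 h2; exfalso; move: c_gt0 h1 h2; clear; lra.
Qed.

Definition mul_bound (R : realType) (C omega : R) (k n : nat) : R :=
  C * n%:R `^ omega * (1 + ln n%:R) ^+ k.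

Section MulBound.
Context (R : realType) (C omega : R) (k : nat).
Let b := mul_bound C omega k.
Hypothesis b_sq : forall n, (0 < n)%N -> (n * n)%:R <= b n.

Lemma mul_bound_C_gt0 : 0 < C.
Proof.
have := b_sq (isT : (0 < 1)%N).
by rewrite /b /mul_bound powR1 ln1 addr0 expr1n !mulr1; apply: lt_le_trans.
Qed.

Lemma ln_nat_ge0 (n : nat) : 0 <= ln n%:R :> R.
Proof. by case: n => [|n]; [rewrite ln0|apply: ln_ge0; rewrite ler1n]. Qed.

(** Otherwise [b_sq] gives n <= C x^k with x = 1 + ln n. Since e^x = e n is at least x^(k+1) /
    (k+1)!, this bounds x by the constant [K] for all n, which fails at n = [N]. *)
Lemma mul_bound_omega_ge1 : 1 <= omega.
Proof.
rewrite leNgt; apply/negP => omega_lt1.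
have C_gt0 := mul_bound_C_gt0.
pose K := expR 1 * C * (k.+1)`!%:R.
have H n : (0 < n)%N -> 1 + ln n%:R <= K.
  move=> n_gt0; set x := 1 + ln n%:R.
  have n_gt0' : 0 < n%:R :> R by rewrite ltr0n.
  have x_gt0 : 0 < x by rewrite ltr_pwDl ?ln_nat_ge0.
  have h1 : n%:R <= C * x ^+ k.
    have := b_sq n_gt0; rewrite natrM /b /mul_bound -/x => h.
    rewrite -(ler_pM2l n_gt0'); apply: le_trans h _.
    rewrite -mulrA [leRHS]mulrCA ler_wpM2l ?(ltW C_gt0) //.
    rewrite ler_wpM2r ?exprn_ge0 ?(ltW x_gt0) //.
    by apply: ler1_powR; rewrite ?ler1n // ltW.
  have h2 : x ^+ k.+1 / (k.+1)`!%:R <= expR 1 * (C * x ^+ k).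
    apply: (@le_trans _ _ (expR x)).
      by apply: le_trans (expR_ge1Dxn k (ltW x_gt0)); rewrite lerDr.
    by rewrite expRD lnK ?posrE // ler_wpM2l ?expR_ge0.
  move: h2; rewrite ler_pdivrMr ?ltr0n ?fact_gt0 // exprS => h2.
  rewrite -(ler_pM2r (exprn_gt0 k x_gt0)); apply: le_trans h2 _.
  by rewrite /K; lra.
pose N := (Num.truncn (expR K)).+1.
have := H N isT; apply/negP; rewrite -ltNge.
apply: (@lt_le_trans _ _ (ln N%:R)); last by rewrite lerDr.
by rewrite -ltr_expR lnK ?posrE ?ltr0n // truncnS_gt.
Qed.

(** Follows from 2 <= 2^omega. It lets two half-size calls be charged to one full-size bound, so
    recursion loses only a logarithmic factor. *)
Lemma mul_bound_double (n : nat) : (0 < n)%N -> 2 * b n <= b (2 * n).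
Proof.
move=> n_gt0; rewrite /b /mul_bound natrM powRM ?ler0n //.
have C_gt0 := mul_bound_C_gt0.
have h2 : 2 <= 2 `^ omega :> R.
  by apply: le1r_powR; rewrite ?mul_bound_omega_ge1 // ler1n.
have hl : (1 + ln n%:R) ^+ k <= (1 + ln (2%:R * n%:R)) ^+ k :> R.
  have l_ge0 := ln_nat_ge0 n.
  have l2_ge0 := ln_nat_ge0 2.
  by apply: lerXn2r; rewrite ?nnegrE ?lnM ?posrE ?ltr0n //; lra.
have p_ge0 : 0 <= C * n%:R `^ omega by rewrite mulr_ge0 ?powR_ge0 // ltW.
rewrite [C * (_ * _)]mulrCA mulrA; apply: ler_pM => //.
- by rewrite mulr_ge0.
- by rewrite exprn_ge0 // addr_ge0 // ln_nat_ge0.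
- by rewrite ler_wpM2r.
Qed.

Lemma mul_bound_ge1 n : (0 < n)%N -> 1 <= b n.
Proof.
move=> n_gt0; apply: le_trans (b_sq n_gt0).
by rewrite ler1n muln_gt0 n_gt0.
Qed.

(** A level adds at most 4 * 2b + 4b = 12b on top of its two recursive calls, and [mul_bound_double]
    absorbs the doubling. *)
Lemma inversion_cost (M I : nat -> nat) :
  (forall n, (0 < n)%N -> (M n)%:R <= 2 * b n) -> I 0%N = 2%N ->
  (forall q, I q.+1 = (2 * I q + 4 * M (2 ^ q) + 4 * (2 ^ q * 2 ^ q))%N) ->
  forall q, (I q)%:R <= (12 * q + 2)%:R * b (2 ^ q)%N.
Proof.
move=> hM I0 IS; elim=> [|q IH].
  rewrite I0 muln0 add0n expn0; have := @mul_bound_ge1 1 isT; lra.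
have q_gt0 : (0 < 2 ^ q)%N by rewrite expn_gt0.
have h1 := hM _ q_gt0; have h2 := b_sq q_gt0; have h3 := mul_bound_double q_gt0.
rewrite IS expnS !natrD !natrM in h2 *.
rewrite natrD natrM in IH.
have h4 : (12 * q%:R + 14) * (2 * b (2 ^ q)%N) <=
  (12 * q%:R + 14) * b (2 * 2 ^ q)%N.
  by rewrite ler_wpM2l // addr_ge0 ?mulr_ge0 ?ler0n.
move: h4; rewrite -[q.+1%:R]natr1; have := mul_bound_ge1 q_gt0.
move: h1 h2 IH.
move: (b _) (b _) (M _)%:R (I _)%:R q%:R ((2 ^ q)%:R * _) => b1 b2 Mq Iq x d.
nra.
Qed.

End MulBound.

Lemma ln2_le1 (R : realType) : ln 2 <= 1 :> R.
Proof. by have := @le_ln1Dx R 1; rewrite -[1 + 1]/(2 : R); apply; lra. Qed.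

Lemma ln2_ge (R : realType) : 1 / 2 <= ln 2 :> R.
Proof.
have := @le_ln1Dx R (- (1 / 2)).
have -> : 1 + - (1 / 2) = 2^-1 :> R by lra.
by rewrite lnV ?posrE // => /(_ _); lra.
Qed.

Lemma pow2_up_log_le (n : nat) : (0 < n)%N -> (2 ^ up_log 2 n <= 2 * n)%N.
Proof.
case: n => [//|[|n]] _; first by rewrite up_log1.
have q_gt0 : (0 < up_log 2 n.+2)%N by rewrite up_log_gt0.
have := @up_log_gtn 2 n.+2 isT isT.
by rewrite -[in X in _ -> X](prednK q_gt0) expnS leq_mul2l => /ltnW ->.
Qed.

Lemma ler_mul_bound (R : realType) (C omega : R) (k m n : nat) :
  0 <= C -> 0 <= omega -> (0 < m)%N -> (m <= n)%N ->
  mul_bound C omega k m <= mul_bound C omega k n.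
Proof.
move=> C_ge0 w_ge0 m_gt0 le_mn; have n_gt0 := leq_trans m_gt0 le_mn.
have := ln_nat_ge0 R m; have := ln_nat_ge0 R n => ln_ge lm_ge.
apply: ler_pM; rewrite ?mulr_ge0 ?powR_ge0 ?exprn_ge0 ?addr_ge0 //.
  by rewrite ler_wpM2l // ge0_ler_powR ?nnegrE ?ler0n // ler_nat.
apply: lerXn2r; rewrite ?nnegrE ?addr_ge0 // lerD2l.
by rewrite ler_ln ?posrE ?ltr0n // ler_nat.
Qed.

Lemma mul_bound_double_le (R : realType) (C omega : R) (k n : nat) :
  0 <= C -> (0 < n)%N ->
  mul_bound C omega k (2 * n) <= mul_bound (C * 2 `^ omega * 2 ^+ k) omega k n.
Proof.
move=> C_ge0 n_gt0; rewrite /mul_bound natrM powRM ?ler0n //.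
have l_ge0 := ln_nat_ge0 R n; have l2 := ln2_le1 R; have l2' := ln2_ge R.
have h : (1 + ln (2%:R * n%:R)) ^+ k <= (2 * (1 + ln n%:R)) ^+ k :> R.
  by apply: lerXn2r; rewrite ?nnegrE ?lnM ?posrE ?ltr0n //; lra.
have -> : C * 2 `^ omega * 2 ^+ k * n%:R `^ omega * (1 + ln n%:R) ^+ k =
  C * (2 `^ omega * n%:R `^ omega) * (2 * (1 + ln n%:R)) ^+ k.
  by rewrite exprMn; ring.
by rewrite ler_wpM2l // !mulr_ge0 ?powR_ge0.
Qed.

(** The matrix is padded to the next power of two, which is at most 2n; the recursion depth accounts
    for the additional logarithm. The lower bound n^2 is exported too, because the cost of the
    descent is charged against it. *)
Lemma fast_inverse (R : realType) (omega : R) :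
  matmul_exponent omega ->
  exists (C : R) (k : nat), forall n : nat, (0 < n)%N ->
    (n * n)%:R <= mul_bound C omega k n /\
    exists2 c : nat, has_inv R n c & c%:R <= mul_bound C omega k n.
Proof.
move=> [C [k htree]]; pose b := mul_bound C omega k.
have b_sq n : (0 < n)%N -> (n * n)%:R <= b n.
  move=> /htree[t ht]; have [|X [Y leXY]] := @mul_tree_time R n t.
    by move=> X Y; have /= := ht X Y; case: exec => pos mem [].
  have /= := ht X Y; case: exec => pos mem [_]; apply: le_trans.
  by rewrite ler_nat.
have C_gt0 := mul_bound_C_gt0 b_sq; have w_ge1 := mul_bound_omega_ge1 b_sq.
have b_ge1 n : (0 < n)%N -> 1 <= b n := @mul_bound_ge1 R C omega k b_sq n.
(* Integer part of the time bound, plus one for the stored 0 of [has_mul_tree]; as b >= 1 this is at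
   most 2b. *)
pose M n := (Num.truncn (b n)).+1.
have hM n : (0 < n)%N -> has_mul R n (M n).
  move=> n_gt0; have [t ht] := htree n n_gt0; apply: (has_mul_tree (t := t)).
  move=> X Y; have /= := ht X Y; case: exec => pos mem [-> le_t]; split => //.
  by rewrite truncn_ge_nat //; exact: le_trans (ler01) (b_ge1 _ n_gt0).
have M_le n : (0 < n)%N -> (M n)%:R <= 2 * b n.
  move=> n_gt0; have b1 := b_ge1 _ n_gt0; rewrite /M -natr1.
  have : (Num.truncn (b n))%:R <= b n by rewrite truncn_le // (le_trans ler01).
  lra.
pose I := fix I q := match q with 0 => 2%N
  | q.+1 => (2 * I q + 4 * M (2 ^ q) + 4 * (2 ^ q * 2 ^ q))%N end.
have hI := has_inv_pow2 hM (erefl : I 0%N = 2%N) (fun q => erefl).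
have I_le q : (I q)%:R <=
  (12 * q + 2)%:R * b (2 ^ q)%N := inversion_cost b_sq M_le
  (erefl : I 0%N = 2%N) (fun q => erefl) q.
(* With L = 1 + ln n and q <= 2L, the factor 12q + 2 is at most 26L; the 2 operations of padding
   bring it to 28L. *)
pose C' := 28 * (C * 2 `^ omega * 2 ^+ k).
exists C', k.+1 => n n_gt0.
have l_ge0 := ln_nat_ge0 R n.
set q := up_log 2 n.
have le_nq : (n <= 2 ^ q)%N by apply: up_logP.
have le_qn : (2 ^ q <= 2 * n)%N by apply: pow2_up_log_le.
have q_le : q%:R <= 2 * (1 + ln n%:R) :> R.
  have : ln (2 ^ q)%N%:R <= ln (2 * n)%N%:R :> R.
    by rewrite ler_ln ?posrE ?ltr0n ?expn_gt0 ?muln_gt0 // ler_nat.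
  rewrite natrX lnXn // natrM lnM ?posrE ?ltr0n // -[ln 2 *+ q]mulr_natl.
  have := ln2_le1 R; have := ln2_ge R; have := ler0n R q; nra.
have b2_le : b (2 ^ q)%N <= mul_bound (C * 2 `^ omega * 2 ^+ k) omega k n.
  apply: le_trans (mul_bound_double_le omega k (ltW C_gt0) n_gt0).
  by apply: ler_mul_bound; rewrite ?expn_gt0 // ltW // (lt_le_trans ltr01).
set b1 := mul_bound (C * _ * _) _ _ _ in b2_le.
have eC' : mul_bound C' omega k.+1 n = 28 * (1 + ln n%:R) * b1.
  by rewrite /mul_bound /C' exprS /b1 /mul_bound; ring.
have b2_ge1 : 1 <= b (2 ^ q)%N by apply: b_ge1; rewrite expn_gt0.
split.
  have h : b n <= b (2 ^ q)%N.
    by apply: ler_mul_bound => //; rewrite ltW // (lt_le_trans ltr01).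
  rewrite eC'; apply: le_trans (b_sq n n_gt0) _; nra.
exists (I q + 2)%N; first by apply: (has_inv_pad (subnKC le_nq)).
rewrite eC' natrD; have := I_le q; rewrite natrD natrM => hIq.
by nra.
Qed.

(** * Accelerated gradient descent *)

Section Acceleration.
Context (R : realType) (V : lmodType R) (ip : V -> V -> R).
Hypothesis ipC : forall x y, ip x y = ip y x.
Hypothesis ipD : forall x y z, ip (x + y) z = ip x z + ip y z.
Hypothesis ipZ : forall c x y, ip (c *: x) y = c * ip x y.
Hypothesis ip_ge0 : forall x, 0 <= ip x x.

Lemma ipDr x y z : ip z (x + y) = ip z x + ip z y.
Proof. by rewrite ipC ipD !(ipC z). Qed.

Lemma ipZr c x y : ip y (c *: x) = c * ip y x.
Proof. by rewrite ipC ipZ (ipC y). Qed.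

Lemma ipN x y : ip (- x) y = - ip x y.
Proof. by rewrite -scaleN1r ipZ mulN1r. Qed.

Lemma ipNr x y : ip x (- y) = - ip x y.
Proof. by rewrite ipC ipN ipC. Qed.

Lemma ip0 x : ip 0 x = 0.
Proof. by rewrite -(scale0r (0 : V)) ipZ mul0r. Qed.

Let ipE := (ipD, ipDr, ipZ, ipZr, ipN, ipNr).

Lemma ip_sub_le x y : ip (x - y) (x - y) <= 2 * ip x x + 2 * ip y y.
Proof. by have := ip_ge0 (x + y); rewrite !ipE (ipC y x); lra. Qed.

Variables (f : V -> R) (gr : V -> V) (a : R).
Hypothesis f_convex : forall y u, f y + ip (gr y) (u - y) <= f u.
Hypothesis f_smooth :
  forall y h, f (y + h) <= f y + ip (gr y) h + 12 * ip h h.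
Hypothesis a_gt0 : 0 < a.
Hypothesis a_le : a <= 1 / 5.

(* The strong convexity parameter [25 a^2 <= 1] added to [f], which makes [F]
   25-smooth, so that [a] is the square root of the inverse condition number. *)
Let delta := 25 * a ^+ 2.
Let F x := f x + delta / 2 * ip x x.
Let G x := delta *: x + gr x.

(** The bracket is [G x]: a gradient step on [F] of length the inverse of its smoothness
    constant. *)
Definition descent (x : V) : V := x - 25^-1 *: (25 * a ^+ 2 *: x + gr x).

(** Nesterov's method with constant momentum for strongly convex functions: [s.1] is the iterate,
    [s.2] the centre of the estimating quadratic. The factor (25 a)^-1 is a / delta. *)
Definition agm_step (s : V * V) : V * V :=
  let y := (1 + a)^-1 *: (s.1 + a *: s.2) in
  (descent y,
   (1 - a) *: s.2 + a *: y - (25 * a)^-1 *: (25 * a ^+ 2 *: y + gr y)).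

Definition agm (N : nat) : V * V := iter N agm_step (0, 0).

Lemma delta_le1 : delta <= 1.
Proof.
have : 0 <= (1 / 5 - a) * (1 / 5 + a).
  by move: a_gt0 a_le => *; rewrite mulr_ge0; lra.
by rewrite /delta; lra.
Qed.

Lemma delta_ge0 : 0 <= delta.
Proof. by rewrite mulr_ge0 // sqr_ge0. Qed.

(** The coefficient 12 of [f_smooth] and delta / 2 <= 1 / 2 add up to at most 25 / 2, so a step of
    length 1 / 25 gains |G y|^2 / 50. *)
Lemma F_descent y : F (descent y) <= F y - ip (G y) (G y) / 50.
Proof.
have [g eg] : {g | g = G y} by exists (G y).
have := f_smooth y (- (25^-1 *: g)).
rewrite /descent -/delta -/(G y) /F -eg !ipE (ipC g y) => h.
have : 0 <= (1 - delta) * ip g g.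
  by rewrite mulr_ge0 ?ip_ge0 // subr_ge0 delta_le1.
have e : ip (gr y) g = ip g g - delta * ip y g.
  by rewrite {2}eg /G ipD ipZ addrC addKr.
move: h; rewrite e.
move: (f _) (f y) (ip y g) (ip g g) (ip y y) => b1 b2 b3 b4 b5.
lra.
Qed.

Lemma F_convex y u :
  F y + ip (G y) (u - y) + delta / 2 * ip (u - y) (u - y) <= F u.
Proof.
have := f_convex y u; rewrite /F /G !ipE (ipC u y); lra.
Qed.

(** The Lyapunov function contracts by 1 - a: add 1 - a times convexity at the old iterate, a times
    strong convexity at [u], and the gain of [F_descent]. *)
Lemma agm_lyapunov u s :
  F (agm_step s).1 - F u +
    delta / 2 * ip ((agm_step s).2 - u) ((agm_step s).2 - u)
  <= (1 - a) * (F s.1 - F u + delta / 2 * ip (s.2 - u) (s.2 - u)).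
Proof.
case: s => x v; rewrite /agm_step /= -/delta.
have [y ey] : {y | y = (1 + a)^-1 *: (x + a *: v)} by eexists.
rewrite -ey -/(G y); have [g eg] : {g | g = G y} by exists (G y).
have [d ed] : {d | d = v - y} by eexists.
have [e ee] : {e | e = u - y} by eexists.
have a1_neq0 : 1 + a != 0 by rewrite lt0r_neq0 // addr_gt0.
have ev : v = y + d by rewrite ed addrC subrK.
have eu : u = y + e by rewrite ee addrC subrK.
(* The coupling weights of [y] are chosen to make x - y and v - y parallel, so the terms linear in d
   cancel. *)
have exy : x - y = - (a *: d).
  have : (1 + a) *: y = x + a *: v by rewrite ey scalerA mulfV // scale1r.
  rewrite scalerDl scale1r ev scalerDr => h.
  have h' : y = x + a *: d.
    by apply: (addIr (a *: y)); rewrite h [a *: y + _]addrC addrA.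
  by rewrite {1}h' opprD addrA subrr add0r.
have ev' : (1 - a) *: v + a *: y - (25 * a)^-1 *: g - u =
    (1 - a) *: d - (25 * a)^-1 *: g - e.
  rewrite ev eu scalerDr [_ + a *: y]addrAC -scalerDl subrK scale1r opprD addrA.
  by rewrite [_ - y]addrAC [y + _]addrC addrK.
have evu : v - u = d - e by rewrite ev eu opprD addrACA subrr add0r.
have hx := F_convex y x; have hu := F_convex y u; have hd := F_descent y.
rewrite -eg ev' evu; move: hx hu hd; rewrite -eg exy -ee.
rewrite !ipE (ipC g d) (ipC g e) (ipC e d).
have := ip_ge0 d; have := ip_ge0 e.
move: (F (descent y)) (F x) (F u) (F y) => Fx' Fx Fu Fy.
move: (ip d d) (ip e e) (ip g g) (ip d e) (ip d g) (ip e g) =>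
  dd ee' gg de dg eg'.
move=> ee0 dd0 hx hu hd.
have {}hx : (1 - a) * (Fy - a * dg) <= (1 - a) * Fx.
  rewrite ler_wpM2l //; first by move: a_le; lra.
  have : 0 <= delta / 2 * (a * (a * dd)).
    by rewrite !mulr_ge0 ?delta_ge0 // ltW.
  by move: hx; lra.
have {}hu : a * (Fy + eg' + delta / 2 * ee') <= a * Fu.
  by rewrite ler_wpM2l ?(ltW a_gt0).
have h : 0 <= delta / 2 * (a * (1 - a) * dd).
  by rewrite !mulr_ge0 ?delta_ge0 ?(ltW a_gt0) // subr_ge0; move: a_le; lra.
(* The squared gradient term created by moving [v] is exactly the gain of the descent step. *)
have e1 : delta / 2 * ((25 * a)^-1 * ((25 * a)^-1 * gg)) = gg / 50.
  by rewrite /delta; field; rewrite lt0r_neq0.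
have e2 t : delta * ((25 * a)^-1 * t) = a * t.
  by rewrite /delta; field; rewrite lt0r_neq0.
have := e2 ((1 - a) * dg); have := e2 eg'; move: hx hu hd h e1;
  move: (25 * a)^-1 => c *.
lra.
Qed.

(** At the starting point 0 the quadratic of the Lyapunov function cancels the regularizer in [F u],
    so only values of [f] remain on the right. *)
Lemma F_agm N u :
  F (agm N).1 - F u <= (1 - a) ^+ N * (f 0 - f u).
Proof.
suff: F (agm N).1 - F u + delta / 2 * ip ((agm N).2 - u) ((agm N).2 - u)
    <= (1 - a) ^+ N * (f 0 - f u).
  apply: le_trans; rewrite lerDl mulr_ge0 ?ip_ge0 //.
  by rewrite divr_ge0 // delta_ge0.
have a1_ge0 : 0 <= 1 - a by move: a_le; lra.
elim: N => [|N IH].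
  rewrite /agm /= expr0 mul1r /F ip0 sub0r !ipE; lra.
rewrite /agm iterS; apply: le_trans (agm_lyapunov u _) _.
by rewrite exprS -[leRHS]mulrA; apply: ler_wpM2l a1_ge0 _ _ IH.
Qed.

(** Write gr x = G x - delta x. Here |G x|^2 / 50 is at most the gap F x - F (descent x), hence at
    most (1 - a)^N Lam, while delta^2 |x|^2 <= 2 delta Lam = 50 a^2 Lam. The 2 of [ip_sub_le] turns
    both 50s into 100. *)
Lemma agm_gradient N (Lam : R) :
  let x := (agm N).1 in
  f 0 <= Lam -> 0 <= f x -> 0 <= f (descent x) ->
  ip (gr x) (gr x) <= 100 * (a ^+ 2 * Lam) + 100 * ((1 - a) ^+ N * Lam).
Proof.
move=> x f0 fx fu.
have h0 : F x <= f 0.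
  by have := F_agm N 0; rewrite subrr mulr0 /F !ip0 mulr0 addr0 subr_le0.
have h1 := F_agm N (descent x); rewrite -/x in h1.
have h2 := F_descent x.
have h3 : (1 - a) ^+ N * (f 0 - f (descent x)) <= (1 - a) ^+ N * Lam.
  rewrite ler_wpM2l ?exprn_ge0 //; first by move: a_le; lra.
  by lra.
have -> : gr x = G x - delta *: x by rewrite /G addrC addKr.
apply: le_trans (ip_sub_le _ _) _; rewrite ipZ ipZr.
have h4 : delta / 2 * ip x x <= Lam by move: h0; rewrite /F; lra.
have h5 : delta * (delta / 2 * ip x x) <= delta * Lam.
  by rewrite ler_wpM2l // delta_ge0.
move: h1 h2 h3 h5; rewrite [in _ * Lam]/delta.
move: (F _) (F _) (ip (G x) (G x)) (ip x x) (_ ^+ N * Lam)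
  (_ ^+ N * _) delta => b1 b2 b3 b4 b5 b6 b7.
lra.
Qed.

End Acceleration.

(** * The logarithm of the potential *)

(* A crude replacement for Hoeffding's lemma: unlike [expR x <= 1 + x + x^2] it
   holds for all x. *)
Lemma expR_le_linear_sq (R : realType) (x : R) : expR x <=
  x + expR (3 * x ^+ 2).
Proof.
have [x_le|x_gt] := lerP x (1 / 3); last first.
  have : expR x <= expR (3 * x ^+ 2) by rewrite ler_expR; nra.
  by lra.
(* For x <= 1/3 the bound e^x <= 1 + x + x^2 holds: e^x (1 - x/2)^2 <= 1, whereas (1 + x + x^2)(1 -
   x/2)^2 = 1 + x^2 (1 - 3x + x^2) / 4 >= 1. *)
have h1 := expR_ge1Dx (- (x / 2)).
have h2 := expR_ge1Dx (3 * x ^+ 2).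
have h3 : expR x * (expR (- (x / 2)) * expR (- (x / 2))) = 1.
  by rewrite -!expRD -[RHS]expR0; congr expR; lra.
suff : expR x <= 1 + x + x ^+ 2 by have := sqr_ge0 x; lra.
have h4 : expR x * ((1 - x / 2) * (1 - x / 2)) <= 1.
  by rewrite -[leRHS]h3 ler_wpM2l ?expR_ge0 //; apply: ler_pM => //; lra.
have h5 : 1 <= (1 + x + x ^+ 2) * ((1 - x / 2) * (1 - x / 2)).
  have : 0 <= x ^+ 2 * (1 - 3 * x + x ^+ 2).
    by rewrite mulr_ge0 ?sqr_ge0 // addr_ge0 ?sqr_ge0 //; lra.
  by lra.
rewrite -(@ler_pM2r _ ((1 - x / 2) * (1 - x / 2))); last by rewrite mulr_gt0;
  lra.
exact: le_trans h5.
Qed.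

(** * Averages of exponentials under a probability vector *)

Section Mean.
Context (R : realType) (m : nat) (l s : 'I_m -> R).
Hypothesis l_ge0 : forall i, 0 <= l i.
Hypothesis l_sum : \sum_i l i = 1.

Let mu := \sum_i l i * s i.

Lemma mean_center : \sum_i l i * (s i - mu) = 0.
Proof.
under eq_bigr do rewrite mulrBr.
by rewrite sumrB -mulr_suml l_sum mul1r subrr.
Qed.

(** Jensen's inequality: average the tangent line of exp at [mu]. *)
Lemma expR_mean_le : expR mu <= \sum_i l i * expR (s i).
Proof.
have -> : expR mu = \sum_i l i * (expR mu * (1 + (s i - mu))).
  under eq_bigr => i _ do rewrite mulrCA mulrDr mulr1.
  by rewrite -mulr_sumr big_split /= mean_center addr0 l_sum mulr1.
apply: ler_sum => i _; rewrite ler_wpM2l //.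
have -> : expR (s i) = expR mu * expR (s i - mu) by rewrite -expRD addrC subrK.
by rewrite ler_wpM2l ?expR_ge0 // expR_ge1Dx.
Qed.

(** A subgaussian bound. Centred values have squares at most 4Q, so [expR_le_linear_sq] contributes
    3 * 4Q in the exponent and its linear term averages to 0. *)
Lemma mean_expR_le (Q : R) :
  (forall i, s i ^+ 2 <= Q) ->
  \sum_i l i * expR (s i) <= expR (mu + 12 * Q).
Proof.
move=> sQ; pose T := Num.sqrt Q.
have Q_ge0 i : 0 <= Q := le_trans (sqr_ge0 _) (sQ i).
have sT i : `|s i| <= T by rewrite -sqrtr_sqr ler_wsqrtr.
have muT : `|mu| <= T.
  apply: le_trans (ler_norm_sum _ _ _) _.
  rewrite -[leRHS]mul1r -l_sum mulr_suml; apply: ler_sum => i _.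
  by rewrite normrM ger0_norm // ler_wpM2l.
have dT i : (s i - mu) ^+ 2 <= 4 * Q.
  rewrite -[Q]sqr_sqrtr ?(Q_ge0 i) // -/T -[leLHS]real_normK ?num_real //.
  have h : `|s i - mu| <= 2 * T.
    apply: le_trans (ler_normB _ _) _; move: (sT i) muT; clear; lra.
  have h0 : 0 <= `|s i - mu| by [].
  have : `|s i - mu| * `|s i - mu| <= (2 * T) * (2 * T) by apply: ler_pM.
  by clear; lra.
have -> : \sum_i l i * expR (s i) = expR mu * \sum_i l i * expR (s i - mu).
  rewrite mulr_sumr; apply: eq_bigr => i _.
  by rewrite mulrCA -expRD addrC subrK.
rewrite expRD ler_wpM2l ?expR_ge0 //.
apply: (@le_trans _ _ (\sum_i l i * ((s i - mu) + expR (12 * Q)))).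
  apply: ler_sum => i _; rewrite ler_wpM2l //.
  apply: le_trans (expR_le_linear_sq _) _; rewrite lerD2l ler_expR.
  by move: (dT i); clear; lra.
under eq_bigr do rewrite mulrDr.
by rewrite big_split /= mean_center add0r -mulr_suml l_sum mul1r.
Qed.

End Mean.

(** * Convexity and smoothness of ln Phi in the norm of H *)

Section Potential.
Context (R : realType) (m n : nat) (H : 'M[R]_n) (A : 'M[R]_(m, n)).
Hypothesis m_gt0 : (0 < m)%N.
Hypothesis posH : posdefmx H.
Hypothesis unitA : forall i, normH (invmx H) (row i A) = 1.

Definition ipmx (x y : 'cV[R]_n) : R := (x^T *m H *m y) 0 0.

(* Minus the gradient of [ln (potential A x)] in the inner product of H, when
   [l = weights A x]. *)
Definition dual_dir (l : 'rV[R]_m) : 'cV[R]_n := invmx H *m (l *m A)^T.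

(** The gradient of ln Phi itself, in the form that [agm] takes as [gr]. *)
Definition neg_dir (x : 'cV[R]_n) : 'cV[R]_n := - dual_dir (weights A x).

Lemma ipmxC x y : ipmx x y = ipmx y x.
Proof.
case: posH => symH _; rewrite /ipmx.
have -> : y^T *m H *m x = (x^T *m H *m y)^T.
  by rewrite !trmx_mul trmxK symH mulmxA.
by rewrite [RHS]mxE.
Qed.

Lemma ipmxD x y z : ipmx (x + y) z = ipmx x z + ipmx y z.
Proof. by rewrite /ipmx linearD /= !mulmxDl mxE. Qed.

Lemma ipmxZ c x y : ipmx (c *: x) y = c * ipmx x y.
Proof. by rewrite /ipmx linearZ /= -!scalemxAl mxE. Qed.

Lemma ipmx_ge0 x : 0 <= ipmx x x.
Proof.
case: posH => _ pos; have [->|/pos/ltW//] := eqVneq x 0.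
by rewrite /ipmx mulmx0 mxE.
Qed.

Lemma ipmx_dual_dir l x : ipmx (dual_dir l) x = \sum_i l 0 i * (A *m x) i 0.
Proof.
have uH := posdefmx_unit posH; case: posH => symH _.
rewrite /ipmx /dual_dir trmx_mul trmxK trmx_inv symH.
by rewrite -[_ *m H]mulmxA mulVmx // mulmx1 -mulmxA mxE.
Qed.

(** [dual_dir l] is the Riesz representative of l A, so its H-norm is the dual norm of l A. *)
Lemma normH_dual_dir l :
  normH (invmx H) (l *m A) = Num.sqrt (ipmx (dual_dir l) (dual_dir l)).
Proof.
by rewrite ipmx_dual_dir /normH -!mulmxA -/(dual_dir l) mxE.
Qed.

(** Cauchy-Schwarz against the representative of row i, which is a unit vector by [unitA]. *)
Lemma sqr_row_le x i : (A *m x) i 0 ^+ 2 <= ipmx x x.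
Proof.
pose l := delta_mx 0 i : 'rV[R]_m; pose t := (A *m x) i 0.
have el : l *m A = row i A by rewrite rowE.
have lb y : ipmx (dual_dir l) y = (A *m y) i 0.
  rewrite ipmx_dual_dir (bigD1 i) //= big1 => [|j ji].
    by rewrite mxE !eqxx mul1r addr0.
  by rewrite mxE (negbTE ji) andbF mul0r.
have bb : ipmx (dual_dir l) (dual_dir l) = 1.
  have := unitA i; rewrite -el normH_dual_dir => h.
  by rewrite -[LHS]sqr_sqrtr ?ipmx_ge0 // h expr1n.
have := ipmx_ge0 (x - t *: dual_dir l).
rewrite -scaleNr !(ipmxD, ipmxZ) ![ipmx _ (_ + _)]ipmxC !(ipmxD, ipmxZ).
rewrite [ipmx x (dual_dir l)]ipmxC bb lb -/t; lra.
Qed.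

Lemma potential_gt0 x : 0 < potential A x.
Proof.
rewrite /potential; case: m m_gt0 A => // m' _ A'.
by rewrite big_ord_recl ltr_pwDl ?expR_gt0 // sumr_ge0 // => i _;
  rewrite expR_ge0.
Qed.

Lemma weights_ge0 x i : 0 <= weights A x 0 i.
Proof. by rewrite mxE mulr_ge0 ?invr_ge0 ?expR_ge0 // ltW // potential_gt0. Qed.

Lemma weights_sum x : \sum_i weights A x 0 i = 1.
Proof.
under eq_bigr do rewrite mxE.
by rewrite -mulr_sumr mulVf // lt0r_neq0 // potential_gt0.
Qed.

(** Factoring out the current weights turns the change of the potential into an average, to which
    the two bounds on exponential means apply. *)
Lemma potentialD x h :
  potential A (x + h) =
  potential A x * \sum_i weights A x 0 i * expR (- (A *m h) i 0).
Proof.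
rewrite mulr_sumr; apply: eq_bigr => i _.
rewrite [weights _ _ _ _]mxE mulrA mulrA mulfV ?lt0r_neq0 ?potential_gt0 //.
by rewrite mul1r -expRD mulmxDr [X in - X]mxE opprD.
Qed.

Lemma neg_dirE x h :
  ipmx (neg_dir x) h = \sum_i weights A x 0 i * - (A *m h) i 0.
Proof.
rewrite /neg_dir -scaleN1r ipmxZ mulN1r ipmx_dual_dir -sumrN.
by under [RHS]eq_bigr do rewrite mulrN.
Qed.

Let f x := ln (potential A x).

Lemma ln_potentialD x h :
  f (x + h) = f x + ln (\sum_i weights A x 0 i * expR (- (A *m h) i 0)).
Proof.
have h0 := potential_gt0 (x + h).
have := h0; rewrite /f potentialD => h1.
by rewrite lnM ?posrE ?potential_gt0 // -(pmulr_rgt0 _ (potential_gt0 x)).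
Qed.

Let mean_gt0 (x h : 'cV[R]_n) :
  0 < \sum_i weights A x 0 i * expR (- (A *m h) i 0).
Proof.
apply: (lt_le_trans (expR_gt0 (\sum_i weights A x 0 i * - (A *m h) i 0))).
apply: expR_mean_le.
  exact: weights_ge0.
exact: weights_sum.
Qed.

Lemma ln_potential_convex y u : f y + ipmx (neg_dir y) (u - y) <= f u.
Proof.
rewrite -[in leRHS](subrK y u) [u - y + y]addrC ln_potentialD lerD2l neg_dirE.
rewrite -ler_expR lnK ?posrE ?mean_gt0 //; apply: expR_mean_le.
  exact: weights_ge0.
exact: weights_sum.
Qed.

Lemma ln_potential_smooth y h :
  f (y + h) <= f y + ipmx (neg_dir y) h + 12 * ipmx h h.
Proof.
rewrite ln_potentialD -addrA lerD2l neg_dirE.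
rewrite -ler_expR lnK ?posrE ?mean_gt0 //; apply: mean_expR_le.
- exact: weights_ge0.
- exact: weights_sum.
- by move=> i; rewrite sqrrN sqr_row_le.
Qed.

Lemma potential0 : potential A 0 = m%:R.
Proof.
rewrite /potential mulmx0; under eq_bigr do rewrite mxE oppr0 expR0.
by rewrite sumr_const card_ord.
Qed.

Lemma potential_cone x : potential A x < 1 -> cone A x.
Proof.
move=> lt1 i; rewrite -oppr_lt0 -expR_lt1; apply: le_lt_trans lt1.
rewrite /potential (bigD1 i) //= lerDl sumr_ge0 // => j _; exact: expR_ge0.
Qed.

(** [agm_gradient] for ln Phi, whose value at the origin is ln m; the two lower bounds on Phi say
    that ln Phi >= 0 at x and at the gradient step from it. *)
Lemma mwu_certificate (a eps : R) (N : nat) :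
  let x := (agm neg_dir a N).1 in
  0 < a -> a <= 1 / 5 -> 0 <= eps ->
  100 * (a ^+ 2 * ln m%:R) + 100 * ((1 - a) ^+ N * ln m%:R) <= eps ^+ 2 ->
  1 <= potential A x -> 1 <= potential A (descent neg_dir a x) ->
  normH (invmx H) (weights A x *m A) <= eps.
Proof.
move=> x a_gt0 a_le eps_ge0 le_eps px pu; rewrite normH_dual_dir.
rewrite -(ger0_norm eps_ge0) -sqrtr_sqr ler_wsqrtr //; apply: le_trans le_eps.
have := @agm_gradient R _ ipmx ipmxC ipmxD ipmxZ ipmx_ge0 f neg_dir a
  ln_potential_convex ln_potential_smooth a_gt0 a_le N (ln m%:R).
rewrite -/x /f potential0 => /(_ (lexx _) (ln_ge0 px) (ln_ge0 pu)).
by rewrite /neg_dir -scaleN1r ipmxZ ipmxC ipmxZ !mulN1r opprK.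
Qed.

End Potential.

(** For fixed beta, [a] is of order 1 / (n (1 + ln m)), which keeps the regularization bias below
    beta / n, and [N] is of order ln(mn) / a, which makes (1 - a)^N polynomially small. The product
    of these orders is O~(n). *)
Lemma agm_parameters (R : realType) (beta : R) : 0 < beta ->
  exists K : R, forall m n : nat, (0 < m)%N -> (0 < n)%N ->
  exists (a : R) (N : nat),
    [/\ 0 < a, a <= 1 / 5,
      100 * (a ^+ 2 * ln m%:R) + 100 * ((1 - a) ^+ N * ln m%:R)
        <= (beta / n%:R) ^+ 2 &
      N%:R <= K * n%:R * (1 + ln (m * n)%:R) ^+ 2].
Proof.
(* The 3 covers ln m + 2 ln n, and 180 / beta^2 enters through 1 + t <= e^t; together e^(kappa ell)
   >= 180 m n^2 / beta^2. *)
move=> b_gt0; pose kappa : R := 3 + 180 / beta ^+ 2.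
exists (kappa * (15 * (1 + beta)) / beta + 1) => m n m_gt0 n_gt0.
pose Lam : R := 1 + ln m%:R; pose ell : R := 1 + ln (m * n)%:R.
have n_ge1 : 1 <= n%:R :> R by rewrite ler1n.
have lm_ge0 := ln_nat_ge0 R m; have ln_ge0 := ln_nat_ge0 R n.
have eell : ell = 1 + ln m%:R + ln n%:R.
  by rewrite /ell natrM lnM ?posrE ?ltr0n // addrA.
have kappa_ge0 : 0 <= kappa by rewrite addr_ge0 // divr_ge0 // sqr_ge0.
(* Using n + beta in place of n keeps a = beta / D at most 1 / 15 however large beta is. *)
pose D : R := 15 * (n%:R + beta) * Lam.
have D_gt0 : 0 < D by rewrite !mulr_gt0 //; rewrite /Lam; lra.
have [a ea] : {a | a = beta / D} by eexists.
pose N := (Num.truncn (kappa * ell / a)).+1.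
have a_gt0 : 0 < a by rewrite ea divr_gt0.
have a_le : a <= 1 / 15.
  rewrite ea ler_pdivrMr // /D; have : 0 <= (n%:R + beta) * ln m%:R.
    by rewrite mulr_ge0 // addr_ge0 // ltW.
  by rewrite /Lam; lra.
exists a, N; split => //; first by lra.
- have h1 : (15 * (Lam * a)) ^+ 2 <= (beta / n%:R) ^+ 2.
    have Lam_ge0 : 0 <= Lam by rewrite /Lam addr_ge0.
    have a_ge0 := ltW a_gt0; have b_ge0 := ltW b_gt0.
    apply: lerXn2r; rewrite ?nnegrE; [|exact: divr_ge0|].
      by apply: mulr_ge0 => //; apply: mulr_ge0.
    rewrite ler_pdivlMr ?ltr0n //.
    have : a * D = beta by rewrite ea divfK // lt0r_neq0.
    have : 0 <= a * (beta * Lam) by apply: mulr_ge0 => //; apply: mulr_ge0.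
    by rewrite /D; lra.
  have h2 : a ^+ 2 * ln m%:R <= (Lam * a) ^+ 2.
    rewrite exprMn mulrC ler_wpM2r ?sqr_ge0 // /Lam;
      have := sqr_ge0 (ln m%:R : R).
    lra.
  have h3 : (1 - a) ^+ N <= expR (- (kappa * ell)).
    apply: (@le_trans _ _ (expR (- a) ^+ N)).
      apply: lerXn2r; rewrite ?nnegrE ?expR_ge0 //; first by lra.
      by rewrite expR_ge1Dx.
    rewrite -expRM_natl ler_expR mulrN lerN2 -ler_pdivrMr //.
    by rewrite /N ltW // truncnS_gt.
  have h4 : m%:R * n%:R ^+ 2 * (180 / beta ^+ 2) <= expR (kappa * ell).
    apply: (@le_trans _ _ (expR (ln m%:R + (ln n%:R + ln n%:R) +
      180 / beta ^+ 2))).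
      rewrite !expRD !lnK ?posrE ?ltr0n // -expr2 ler_wpM2l ?mulr_ge0 ?sqr_ge0
        //.
      by apply: le_trans (expR_ge1Dx _); lra.
    have k_ge0 : 0 <= 180 / beta ^+ 2 by rewrite divr_ge0 // sqr_ge0.
    rewrite ler_expR eell /kappa; move: (180 / _) k_ge0 => k k_ge0; nra.
  have h5 : (1 - a) ^+ N * ln m%:R <= beta ^+ 2 / (180 * n%:R ^+ 2).
    have m_gt0' : 0 < m%:R :> R by rewrite ltr0n.
    apply: (@le_trans _ _ (expR (- (kappa * ell)) * m%:R)).
      apply: ler_pM => //; first by rewrite exprn_ge0 //; lra.
      by apply/ltW/ln_sublinear.
    rewrite expRN mulrC ler_pdivrMr ?expR_gt0 //.
    rewrite -[leLHS](_ : beta ^+ 2 / (180 * n%:R ^+ 2) *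
      (m%:R * n%:R ^+ 2 * (180 / beta ^+ 2)) = _).
      by rewrite ler_wpM2l // divr_ge0 ?sqr_ge0 // mulr_ge0 ?sqr_ge0.
    by field; rewrite (lt0r_neq0 b_gt0) pnatr_eq0 -lt0n n_gt0.
  (* The two terms receive the shares 100/225 and 100/180 of (beta / n)^2, which sum to 1. *)
  have e : (beta / n%:R) ^+ 2 = 180 * (beta ^+ 2 / (180 * n%:R ^+ 2)).
    by field; rewrite pnatr_eq0 -lt0n.
  rewrite e in h1 *; move: h1 h2 h5; move: (_ / _) => x;
    move: (_ ^+ N * _) (a ^+ 2 * _) => y z; lra.
- have h1 : (Num.truncn (kappa * ell / a))%:R <= kappa * ell / a.
    by rewrite truncn_le // !mulr_ge0 ?invr_ge0 // ?ltW //; rewrite eell; lra.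
  have ell_ge1 : 1 <= ell by rewrite eell; lra.
  have n_ell : 1 <= n%:R * ell ^+ 2.
    by rewrite -[leLHS]mulr1; apply: ler_pM => //; rewrite exprn_ege1.
  have h2 : kappa * ell / a <=
    kappa * (15 * (1 + beta)) / beta * (n%:R * ell ^+ 2).
    have -> : kappa * ell / a = kappa / beta * (ell * D).
      by rewrite ea; field; rewrite !lt0r_neq0.
    have -> : kappa * (15 * (1 + beta)) / beta * (n%:R * ell ^+ 2) =
        kappa / beta * (15 * (1 + beta) * (n%:R * ell ^+ 2)).
      by field; rewrite lt0r_neq0.
    rewrite ler_wpM2l ?divr_ge0 ?(ltW b_gt0) // /D.
    have h : (n%:R + beta) * Lam <= (1 + beta) * n%:R * ell.
      apply: ler_pM; rewrite /Lam ?eell; try lra.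
      have : 0 <= beta * (n%:R - 1) by rewrite mulr_ge0; lra.
      by lra.
    have : 0 <= ell * ((1 + beta) * n%:R * ell - (n%:R + beta) * Lam).
      by rewrite mulr_ge0 ?subr_ge0 //; lra.
    by lra.
  by rewrite /N -natr1; move: h1 h2 n_ell; rewrite -/ell; lra.
Qed.

(** * The program *)

Section Program.
Context (R : realType) (m n : nat) (H : 'M[R]_n) (A : 'M[R]_(m, n)).
Hypothesis m_gt0 : (0 < m)%N.
Hypothesis n_gt0 : (0 < n)%N.
Let B := invmx H *m A^T.

(** Computing H^-1 A^T once, for O(m n^2), lets every later gradient be obtained from the weights in
    O(m n). *)
Definition pdualmx (PK : 'M[nat]_n) (PA : 'M[nat]_(m, n)) : prog R 'M[nat]_(n,
  m) :=
  pmx (fun j i => sum_expr (fun k => EMul (EVar (PK j k)) (EVar (PA i k)))).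

Lemma spec_pdualmx mem PK PA :
  holdsmx mem PK (invmx H) -> holdsmx mem PA A ->
  spec (pdualmx PK PA) mem (fun PB mem' =>
    holdsmx mem' PB B) (n * m * (n * 2 + 1)).
Proof.
move=> hK hA; apply: spec_pmx => [j i|j i]; last exact: esize_sum.
have -> : B j i = \sum_k invmx H j k * A i k.
  by rewrite mxE; apply: eq_bigr => k _; rewrite [A^T _ _]mxE.
by apply: evalsto_sum => k; do !constructor.
Qed.

Definition pweights (PA : 'M[nat]_(m, n)) (x : 'cV[nat]_n) :
    prog R (nat * 'rV[nat]_m) :=
  pbind (pmx (fun (_ : 'I_1) i => EExp (ESub (EConst 0)
    (sum_expr (fun j => EMul (EVar (PA i j)) (EVar (x j 0))))))) (fun w =>
  pbind (compile (sum_expr (fun i => EVar (w 0 i)))) (fun s =>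
  pbind (pmx (fun (_ : 'I_1) i =>
    EMul (EDiv (EConst 1) (EVar s)) (EVar (w 0 i))))
    (fun l => pret R (s, l)))).

Lemma spec_pweights mem PA x (X : 'cV[R]_n) :
  holdsmx mem PA A -> holdsmx mem x X ->
  spec (pweights PA x) mem (fun r mem' =>
    holds mem' r.1 (potential A X) /\ holdsmx mem' r.2 (weights A X))
    (13 * (m * n)).
Proof.
move=> hA hx.
apply: (@spec_cost _ _ _ _ _
  (1 * m * (n * 2 + 4) + ((m * 1 + 1) + (1 * m * 3 + 0)))); last nia.
apply: spec_bind.
  apply: (@spec_pmx _ _ _ _ (\row_i expR (- (A *m X) i 0))) => [k i|k i].
    rewrite 2!mxE -sub0r.
    apply: evalsto_exp; apply: evalsto_sub; first exact: evalsto_const.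
    by apply: evalsto_sum => j; do !constructor.
  have := @esize_sum R n (fun j => EMul (EVar (PA i j)) (EVar (x j 0))) 1.
  by move=> /(_ (fun _ => isT)) /=; lia.
move=> w e1 hw.
apply: spec_bind.
  apply: spec_cost (@spec_compile _ _ _ (potential A X) _) (esize_sum _) => //.
  apply: evalsto_sum => i; apply: evalsto_var.
  by have := hw 0 i; rewrite mxE.
move=> s e2 hs.
apply: spec_bind.
  apply: (@spec_pmx _ _ _ _ (weights A X) _ 3) => // k i.
  rewrite mxE -[_^-1]mul1r; do 2!constructor => //; try by constructor.
  by apply: holds_cat; have := hw 0 i; rewrite mxE.
move=> l e3 hl; apply: spec_ret; split => //.
exact: holds_cat.
Qed.

Definition pdual (PB : 'M[nat]_(n, m)) (l : 'rV[nat]_m) : prog R 'cV[nat]_n :=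
  pmx (fun j (_ : 'I_1) => sum_expr (fun i =>
    EMul (EVar (PB j i)) (EVar (l 0 i)))).

Lemma spec_pdual mem PB l L :
  holdsmx mem PB B -> holdsmx mem l L ->
  spec (pdual PB l) mem (fun p mem' => holdsmx mem' p (dual_dir H A L))
    (3 * (m * n)).
Proof.
move=> hB hl; apply: (@spec_cost _ _ _ _ _ (n * 1 * (m * 2 + 1))); last nia.
apply: spec_pmx => [j k|j k]; last exact: esize_sum.
have -> : dual_dir H A L j k = \sum_i B j i * L 0 i.
  rewrite /dual_dir trmx_mul mulmxA mxE; apply: eq_bigr => i _.
  by rewrite [L^T _ _]mxE ord1.
by apply: evalsto_sum => i; do !constructor.
Qed.

Definition pgrad PA PB x : prog R 'cV[nat]_n :=
  pbind (pweights PA x) (fun r => pdual PB r.2).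

Lemma spec_pgrad mem PA PB x (X : 'cV[R]_n) :
  holdsmx mem PA A -> holdsmx mem PB B -> holdsmx mem x X ->
  spec (pgrad PA PB x) mem
    (fun p mem' => holdsmx mem' p (dual_dir H A (weights A X))) (16 * (m * n)).
Proof.
move=> hA hB hx; rewrite (_ : 16 * _ = 13 * (m * n) + 3 * (m * n))%N; last lia.
apply: spec_bind (spec_pweights hA hx) _ => r ext [_ hl].
by apply: spec_pdual => //; apply: holdsmx_cat.
Qed.

Variable a : R.
Let gr := neg_dir H A.

(** [p] holds [dual_dir], which is minus the gradient; hence a subtraction where [descent] adds. *)
Definition pdescent (x p : 'cV[nat]_n) : prog R 'cV[nat]_n :=
  pmx (fun j (_ : 'I_1) => ESub (EVar (x j 0)) (EMul (EConst 25^-1)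
    (ESub (EMul (EConst (25 * a ^+ 2)) (EVar (x j 0))) (EVar (p j 0))))).

Lemma spec_pdescent mem x p X :
  holdsmx mem x X -> holdsmx mem p (dual_dir H A (weights A X)) ->
  spec (pdescent x p) mem
    (fun x' mem' => holdsmx mem' x' (descent gr a X)) (6 * (m * n)).
Proof.
move=> hx hp; apply: (@spec_cost _ _ _ _ _ (n * 1 * 6)); last nia.
apply: spec_pmx => // j k; rewrite ord1.
have -> : descent gr a X j 0 =
    X j 0 - 25^-1 * (25 * a ^+ 2 * X j 0 - dual_dir H A (weights A X) j 0).
  by rewrite /descent /gr /neg_dir !(mxBE, mxE).
by do !constructor.
Qed.

Definition pstep PA PB (s : 'cV[nat]_n * 'cV[nat]_n) :
    prog R ('cV[nat]_n * 'cV[nat]_n) :=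
  pbind (pmx (fun j (_ : 'I_1) => EMul (EConst (1 + a)^-1)
    (EAdd (EVar (s.1 j 0)) (EMul (EConst a) (EVar (s.2 j 0)))))) (fun y =>
  pbind (pgrad PA PB y) (fun p =>
  pbind (pdescent y p) (fun x =>
  pbind (pmx (fun j (_ : 'I_1) => ESub
      (EAdd (EMul (EConst (1 - a)) (EVar (s.2 j 0))) (EMul (EConst a) (EVar
        (y j 0))))
      (EMul (EConst (25 * a)^-1)
        (ESub (EMul (EConst (25 * a ^+ 2)) (EVar (y j 0))) (EVar (p j 0))))))
    (fun v => pret R (x, v))))).

Definition holds_state mem (s : 'cV[nat]_n * 'cV[nat]_n)
  (S : 'cV[R]_n * 'cV[R]_n) :=
  holdsmx mem s.1 S.1 /\ holdsmx mem s.2 S.2.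

Lemma spec_pstep mem PA PB s S :
  holdsmx mem PA A -> holdsmx mem PB B -> holds_state mem s S ->
  spec (pstep PA PB s) mem
    (fun s' mem' => holds_state mem' s' (agm_step gr a S)) (40 * (m * n)).
Proof.
move=> hA hB [hx hv].
apply: (@spec_cost _ _ _ _ _
  (n * 1 * 5 + (16 * (m * n) + (6 * (m * n) + (n * 1 * 11 + 0))))); last nia.
have [Y eY] : {Y | Y = (1 + a)^-1 *: (S.1 + a *: S.2)} by eexists.
apply: spec_bind.
  apply: (@spec_pmx _ _ _ _ Y _ 5) => // j k.
  rewrite ord1 (_ : Y j 0 = (1 + a)^-1 * (S.1 j 0 + a * S.2 j 0)).
    by do !constructor.
  by rewrite eY !mxE.
move=> y e1 hy; apply: spec_bind.
  by apply: spec_pgrad hy; apply: holdsmx_cat.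
move=> p e2 hp; apply: spec_bind.
  by apply: spec_pdescent hp; apply: holdsmx_cat.
move=> x e3 hx'; apply: spec_bind.
  apply: (@spec_pmx _ _ _ _ (agm_step gr a S).2 _ 11) => // j k; rewrite ord1.
  have -> : (agm_step gr a S).2 j 0 =
      (1 - a) * S.2 j 0 + a * Y j 0 -
      (25 * a)^-1 * (25 * a ^+ 2 * Y j 0 - dual_dir H A (weights A Y) j 0).
    by rewrite /agm_step /= -eY /gr /neg_dir !(mxBE, mxE).
  do !constructor.
  - by do 3!apply: holds_cat; exact: hv.
  - by do 2!apply: holds_cat; exact: hy.
  - by do 2!apply: holds_cat; exact: hy.
  - by apply: holds_cat; exact: hp.
move=> v e4 hv'; apply: spec_ret; split; last exact: hv'.
have -> : (agm_step gr a S).1 = descent gr a Y by rewrite eY.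
exact: (holdsmx_cat e4 hx').
Qed.

(** The loop is unrolled when the tree is built, which is possible because the number of steps is
    fixed by m, n and beta. *)
Fixpoint ploop PA PB (N : nat) s : prog R ('cV[nat]_n * 'cV[nat]_n) :=
  if N is N'.+1 then pbind (ploop PA PB N' s) (pstep PA PB) else pret R s.

Lemma spec_ploop mem PA PB N s S :
  holdsmx mem PA A -> holdsmx mem PB B -> holds_state mem s S ->
  spec (ploop PA PB N s) mem
    (fun s' mem' => holds_state mem' s' (iter N (agm_step gr a) S))
    (N * (40 * (m * n))).
Proof.
move=> hA hB hs; elim: N => [|N IH]; first exact: spec_ret.
rewrite mulSn addnC; apply: spec_bind IH _ => s' ext hs'.
by apply: spec_pstep hs'; apply: holdsmx_cat.
Qed.


(** * The returned phases and their correctness *)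

Definition pphase0 (x0 : 'cV[nat]_n) (one s0 : nat) (l0 : 'rV[nat]_m) :
    phase nat m n :=
  Phase 0 (fun _ => x0) (fun _ => s0) (fun _ => l0) (fun _ => one)
    (fun _ => x0) (Certificate _ l0).

(* The single update goes from the origin to the result of the accelerated
   descent, with step size 1. *)
Definition pphase1 (x0 : 'cV[nat]_n) (one s0 : nat) (l0 : 'rV[nat]_m)
    (x : 'cV[nat]_n) (s : nat) (l : 'rV[nat]_m) (res : answer nat m n) :
    phase nat m n :=
  Phase 1 (fun t => if t is 0 then x0 else x) (fun t =>
    if t is 0 then s0 else s)
    (fun t => if t is 0 then l0 else l) (fun _ => one) (fun _ => x) res.

Definition phase_correct (beta : R) (run : phase R m n) : Prop :=
  is_mwu_phase H A beta run /\
  match result run with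
  | Feasible x => cone A x
  | Certificate l =>
      [/\ forall i, 0 <= l 0 i, \sum_(i < m) `|l 0 i| = 1 &
          normH (invmx H) (l *m A) <= beta / n%:R]
  end.

Lemma weights_norm_sum x : \sum_(i < m) `|weights A x 0 i| = 1.
Proof.
rewrite -(weights_sum A m_gt0 x); apply: eq_bigr => i _.
by rewrite ger0_norm // weights_ge0.
Qed.

Lemma pphase0_correct beta mem x0 one s0 l0 :
  holdsmx mem x0 (0 : 'cV[R]_n) -> holds mem s0 (potential A 0) ->
  holdsmx mem l0 (weights A 0) ->
  normH (invmx H) (weights A 0 *m A) <= beta / n%:R ->
  phase_correct beta (map_phase (nth 0 mem) (pphase0 x0 one s0 l0)).
Proof.
move=> hx hs hl small; rewrite /phase_correct /is_mwu_phase /=.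
rewrite (holdsmx_map hx) (holdsmx_map hl) (holds_nth hs).
split; first by split.
split; [by move=> i; apply: weights_ge0|exact: weights_norm_sum|exact: small].
Qed.

Lemma pphase1_correct beta mem x0 one s0 l0 x s l X res :
  holdsmx mem x0 (0 : 'cV[R]_n) -> holds mem one 1 ->
  holds mem s0 (potential A 0) -> holdsmx mem l0 (weights A 0) ->
  holdsmx mem x X -> holds mem s (potential A X) ->
    holdsmx mem l (weights A X) ->
  ~ normH (invmx H) (weights A 0 *m A) <= beta / n%:R ->
  match res with
  | Feasible y => y = x /\ potential A X < 1
  | Certificate k => k = l /\ normH (invmx H) (weights A X *m A) <= beta / n%:R
  end ->
  phase_correct beta (map_phase (nth 0 mem) (pphase1 x0 one s0 l0 x s l res)).
Proof.
move=> hx0 h1 hs0 hl0 hx hs hl nsmall hres.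
rewrite /phase_correct /is_mwu_phase /=.
rewrite (holdsmx_map hx0) (holds_nth h1).
split.
  split=> //.
  - case=> [|t] _; first by rewrite (holdsmx_map hx0) (holds_nth hs0)
      (holdsmx_map hl0).
    by rewrite (holdsmx_map hx) (holds_nth hs) (holdsmx_map hl).
  (* Phi is m >= 1 at the origin, so the phase may not stop there as feasible and the update is
     legal. *)
  - case=> // _; rewrite (holds_nth hs0) (holdsmx_map hl0) (holdsmx_map hx0).
    by rewrite scale1r add0r potential0 ler1n.
  - case: res hres => [y [-> lt1]|k [-> small]] /=.
      by rewrite (holds_nth hs).
    by rewrite (holdsmx_map hl); exact: conj small.
case: res hres => [y [-> lt1]|k [-> small]] /=.
  by rewrite (holdsmx_map hx); apply: potential_cone.
rewrite (holdsmx_map hl).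
split; [by move=> i; apply: weights_ge0|exact: weights_norm_sum|exact: small].
Qed.

(** Everything is computed before the first test. The squared norm is compared with [eps ^+ 2], as
    square roots are not among the operations. The tests ask in turn whether the origin already
    gives a certificate, whether Phi < 1 at the gradient step [u], and whether Phi < 1 at the final
    iterate; otherwise the weights at that iterate are the certificate. *)
Definition pmain (pinv : 'M[nat]_n -> prog R 'M[nat]_n) (eps : R) (N : nat)
    (PH : 'M[nat]_n) (PA : 'M[nat]_(m, n)) : prog R (phase nat m n) :=
  pbind (pinv PH) (fun PK =>
  pbind (pdualmx PK PA) (fun PB =>
  pbind (pop (Const 0)) (fun zero =>
  pbind (pop (Const 1)) (fun one =>
  pbind (pop (Const (eps ^+ 2))) (fun thr =>
  let x0 := const_mx zero in
  pbind (pweights PA x0) (fun w0 =>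
  pbind (pdual PB w0.2) (fun p0 =>
  pbind (compile (sum_expr (fun j : 'I_n => EMul (EVar (p0 j 0))
           (sum_expr (fun i : 'I_m =>
             EMul (EVar (w0.2 0 i)) (EVar (PA i j)))))))
    (fun sq =>
  pbind (ploop PA PB N (x0, x0)) (fun xv =>
  pbind (pweights PA xv.1) (fun w =>
  pbind (pdual PB w.2) (fun p =>
  pbind (pdescent xv.1 p) (fun u =>
  pbind (pweights PA u) (fun wu =>
  pif sq thr (pret R (pphase0 x0 one w0.1 w0.2))
  (pif one wu.1
    (pif one w.1
      (pret R (pphase1 x0 one w0.1 w0.2 xv.1 w.1 w.2 (Certificate _ w.2)))
      (pret R (pphase1 x0 one w0.1 w0.2 xv.1 w.1 w.2 (Feasible _ xv.1))))
    (pret R (pphase1 x0 one w0.1 w0.2 u wu.1 wu.2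
      (Feasible _ u))))))))))))))))).

Lemma spec_pmain pinv beta N PH PA mem c :
  posdefmx H -> (forall i, normH (invmx H) (row i A) = 1) ->
  (forall mem PM M, posdefmx M -> holdsmx mem PM M ->
    spec (pinv PM) mem (fun W mem' => holdsmx mem' W (invmx M)) c) ->
  holdsmx mem PH H -> holdsmx mem PA A ->
  0 < a -> a <= 1 / 5 -> 0 < beta ->
  100 * (a ^+ 2 * ln m%:R) + 100 * ((1 - a) ^+ N * ln m%:R) <=
    (beta / n%:R) ^+ 2 ->
  spec (pmain pinv (beta / n%:R) N PH PA) mem
    (fun pos mem' => phase_correct beta (map_phase (nth 0 mem') pos))
    (c + m * n * (3 * n + 40 * N + 100)).
Proof.
move=> posH unitA hinv hPH hPA a_gt0 a_le beta_gt0.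
have : 0 < beta / n%:R by rewrite divr_gt0 ?ltr0n.
set eps := beta / n%:R => eps_gt0 small_eps.
pose w := (13 * (m * n))%N; pose d := (3 * (m * n))%N.
have le_n : (n <= m * n)%N by rewrite leq_pmull.
have le_1 : (1 <= m * n)%N by rewrite muln_gt0 m_gt0.
apply: (@spec_cost _ _ _ _ _ (c + (n * m * (n * 2 + 1) + (1 + (1 + (1 + (w +
  (d +
  (n * (m * 2 + 1).+2 + 1 + (N * (40 * (m * n)) + (w + (d + (6 * (m * n) +
    (w + 3)))))))))))))); last by rewrite /w /d; lia.
apply: spec_bind (hinv _ _ _ posH hPH) _ => PK e1 hPK.
have {}hPA := holdsmx_cat e1 hPA.
apply: spec_bind (spec_pdualmx hPK hPA) _ => PB {PK hPK hPH} e2.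
have {}hPA := holdsmx_cat e2 hPA.
move: (_ ++ e2) hPA => {e1 e2}mem1 hPA hPB.
apply: spec_bind (spec_pop _ _) _ => zero e1 hzero.
apply: spec_bind (spec_pop _ _) _ => one e2 hone.
apply: spec_bind (spec_pop _ _) _ => thr e3 hthr.
have {}hPA := holdsmx_cat e3 (holdsmx_cat e2 (holdsmx_cat e1 hPA)).
have {}hPB := holdsmx_cat e3 (holdsmx_cat e2 (holdsmx_cat e1 hPB)).
have {}hone : holds _ one 1 := holds_cat e3 hone.
have {}hzero : holds _ zero 0 := holds_cat e3 (holds_cat e2 hzero).
have {}hthr : holds _ thr (eps ^+ 2) := hthr.
move: (_ ++ e3) hPA hPB hone hzero hthr =>
  {e1 e2 e3 mem1}mem1 hPA hPB hone hzero hthr.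
have hx0 : holdsmx mem1 (const_mx zero) (0 : 'cV[R]_n).
  by move=> i j; rewrite !mxE.
move: (const_mx zero) hx0 => x0 hx0 {zero hzero} /=.
apply: spec_bind (spec_pweights hPA hx0) _ => [[s0 l0]] e1 [/= hs0 hl0].
have {}hPA := holdsmx_cat e1 hPA; have {}hPB := holdsmx_cat e1 hPB.
have {}hx0 := holdsmx_cat e1 hx0.
have {}hone := holds_cat e1 hone; have {}hthr := holds_cat e1 hthr.
apply: spec_bind (spec_pdual hPB hl0) _ => p0 e2 hp0.
have {}hPA := holdsmx_cat e2 hPA; have {}hPB := holdsmx_cat e2 hPB.
have {}hx0 := holdsmx_cat e2 hx0; have {}hl0 := holdsmx_cat e2 hl0.
have {}hone := holds_cat e2 hone; have {}hthr := holds_cat e2 hthr.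
have {}hs0 := holds_cat e2 hs0.
pose L0 := weights A 0.
pose D0 := dual_dir H A L0.
apply: spec_bind.
  apply: (@spec_cost _ _ _ _ _ _ (n * (m * 2 + 1).+2 + 1)).
    apply: (@spec_compile _ _ _ (\sum_j D0 j 0 * \sum_i L0 0 i * A i j)).
    apply: evalsto_sum => j; apply: evalsto_mul;
      first exact: evalsto_var (hp0 _ _).
    by apply: evalsto_sum => i; do !constructor.
  apply: esize_sum => j /=.
  have := @esize_sum R m (fun i => EMul (EVar (l0 0 i)) (EVar (PA i j))) 1.
  by move=> /(_ (fun _ => isT)) /=; lia.
move=> sq e3 hsq.
(* The program obtains the squared dual norm by pairing l A with its representative. *)
have eD0 : \sum_j D0 j 0 * (\sum_i L0 0 i * A i j) = ipmx H D0 D0.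
  rewrite ipmx_dual_dir // -/D0.
  under eq_bigr do rewrite mulr_sumr.
  rewrite exchange_big; apply: eq_bigr => i _ /=.
  by rewrite [(A *m _) i 0]mxE mulr_sumr; apply: eq_bigr => j _;
    rewrite mulrC mulrA.
rewrite eD0 in hsq.
have {}hPA := holdsmx_cat e3 hPA; have {}hPB := holdsmx_cat e3 hPB.
have {}hx0 := holdsmx_cat e3 hx0; have {}hl0 := holdsmx_cat e3 hl0.
have {}hone := holds_cat e3 hone; have {}hthr := holds_cat e3 hthr.
have {}hs0 := holds_cat e3 hs0.
move: (_ ++ e3) hPA hPB hone hthr hx0 hs0 hl0 hsq => {mem1 hp0 p0 e1 e2 e3}mem1.
move=> hPA hPB hone hthr hx0 hs0 hl0 hsq.
apply: spec_bind (@spec_ploop _ _ _ N (x0, x0) (0,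
  0) hPA hPB (conj hx0 hx0)) _ => [[x v]] e1.
rewrite -/(agm gr a N); case E : (agm gr a N) => [X V] [/= hx _].
have {}hPA := holdsmx_cat e1 hPA; have {}hPB := holdsmx_cat e1 hPB.
apply: spec_bind (spec_pweights hPA hx) _ => [[s l]] e2 [/= hs hl].
have {}hPA := holdsmx_cat e2 hPA; have {}hPB := holdsmx_cat e2 hPB.
have {}hx := holdsmx_cat e2 hx.
apply: spec_bind (spec_pdual hPB hl) _ => p e3 hp.
have {}hPA := holdsmx_cat e3 hPA; have {}hx := holdsmx_cat e3 hx.
apply: spec_bind (spec_pdescent hx hp) _ => u e4 hu.
have {}hPA := holdsmx_cat e4 hPA.
apply: spec_bind (spec_pweights hPA hu) _ => [[su lu]] e5 [/= hsu hlu].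
have {}hx0 := holdsmx_cat e5 (holdsmx_cat e4 (holdsmx_cat e3 (holdsmx_cat e2
  (holdsmx_cat e1 hx0)))).
have {}hl0 := holdsmx_cat e5 (holdsmx_cat e4 (holdsmx_cat e3 (holdsmx_cat e2
  (holdsmx_cat e1 hl0)))).
have {}hs0 := holds_cat e5 (holds_cat e4 (holds_cat e3 (holds_cat e2
  (holds_cat e1 hs0)))).
have {}hone := holds_cat e5 (holds_cat e4 (holds_cat e3 (holds_cat e2
  (holds_cat e1 hone)))).
have {}hthr := holds_cat e5 (holds_cat e4 (holds_cat e3 (holds_cat e2
  (holds_cat e1 hthr)))).
have {}hsq := holds_cat e5 (holds_cat e4 (holds_cat e3 (holds_cat e2
  (holds_cat e1 hsq)))).
have {}hx := holdsmx_cat e5 (holdsmx_cat e4 hx).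
have {}hu := holdsmx_cat e5 hu.
have {}hs := holds_cat e5 (holds_cat e4 (holds_cat e3 hs)).
have {}hl := holdsmx_cat e5 (holdsmx_cat e4 (holdsmx_cat e3 hl)).
have small0 : (normH (invmx H) (L0 *m A) <= eps) = (ipmx H D0 D0 <= eps ^+ 2).
  rewrite normH_dual_dir // -{1}(ger0_norm
    (ltW eps_gt0)) -sqrtr_sqr ler_sqrt //.
  by rewrite sqr_ge0.
move: (_ ++ e5) hx0 hl0 hs0 hone hthr hsq hx hu hs hl hsu hlu => {hPA}mem' *.
apply: (@spec_pif _ _ _ _ _ _ _ _ _ (ipmx H D0 D0) (eps ^+ 2)) =>
  // [le_sq|lt_sq].
  apply: spec_ret; apply: pphase0_correct => //.
  by rewrite small0.
have nsmall : ~ normH (invmx H) (weights A 0 *m A) <= eps.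
  by rewrite small0 leNgt lt_sq.
apply: (@spec_pif _ _ _ _ _ _ _ _ _ 1 (potential A (descent gr a X))) =>
  // [pu|pu]; last first.
  by apply: spec_ret; apply: (@pphase1_correct _ _ _ _ _ _ _ _ _
    (descent gr a X)).
apply: (@spec_pif _ _ _ _ _ _ _ _ _ 1 (potential A X)) => // [px|px];
  last first.
  by apply: spec_ret; apply: (@pphase1_correct _ _ _ _ _ _ _ _ _ X).
apply: spec_ret; apply: (@pphase1_correct _ _ _ _ _ _ _ _ _ X) => //;
  split => //.
have := @mwu_certificate _ _ _ H A m_gt0 posH unitA a eps N a_gt0 a_le
  (ltW eps_gt0) small_eps.
by rewrite -/gr E; apply.
Qed.

End Program.

(** * Assembly of the running time *)

Theorem lemma13 (R : realType) (omega : R) (homega : matmul_exponent omega) :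
  exists k : nat, forall beta : R, 0 < beta ->
  exists C : R, forall m n : nat, (0 < m)%N -> (0 < n)%N ->
  exists t : ctree R (phase nat m n),
  forall (H : 'M[R]_n) (A : 'M[R]_(m, n)),
    posdefmx H ->
    (forall i, normH (invmx H) (row i A) = 1) ->
    cone A !=set0 ->
    let input := mx_entries H ++ mx_entries A in
    let: (pos, mem) := exec t input in
    let run := map_phase (nth 0 mem) pos in
    [/\ (time t input)%:R
          <= C * (m%:R * n%:R `^ omega) * (1 + ln (m * n)%:R) ^+ k,
        is_mwu_phase H A beta run &
        match result run with
        | Feasible x => cone A x
        | Certificate l =>
            [/\ forall i, 0 <= l 0 i,
                \sum_(i < m) `|l 0 i| = 1 &
                normH (invmx H) (l *m A) <= beta / n%:R]
        end].
Proof.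
have [C1 [k1 hinv]] := fast_inverse homega.
exists (k1 + 2)%N => beta beta_gt0.
have [K hK] := agm_parameters beta_gt0.
(* With ell = 1 + ln(mn), the factor 3n + 40N + 100 is at most (103 + 40|K|) n ell^2, and inverting
   [H] accounts for the remaining 1. The square of ell is the 2 in the exponent k1 + 2. *)
exists (C1 * (104 + 40 * `|K|)) => m n m_gt0 n_gt0.
have [a [N [a_gt0 a_le small N_le]]] := hK m n m_gt0 n_gt0.
have [n2_le [c [pinv hpinv] c_le]] := hinv n n_gt0.
pose PH : 'M[nat]_n := \matrix_(i, j) (i * n + j)%N.
pose PA : 'M[nat]_(m, n) := \matrix_(i, j) (n * n + (i * n + j))%N.
exists (pmain a pinv (beta / n%:R) N PH PA (n * n + m * n)) =>
  H A posH unitA _ input.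
have sz : size input = (n * n + m * n)%N by rewrite size_cat !size_mx_entries.
have hPH : holdsmx input PH H.
  move=> i j ext; rewrite mxE -catA nth_cat size_mx_entries ltn_mx_pos.
  exact: nth_mx_entries.
have hPA : holdsmx input PA A.
  move=> i j ext; rewrite mxE -catA nth_cat size_mx_entries ltnNge leq_addr /=.
  rewrite addKn nth_cat size_mx_entries ltn_mx_pos; exact: nth_mx_entries.
have := spec_pmain m_gt0 n_gt0 posH unitA hpinv hPH hPA a_gt0 a_le beta_gt0
  small.
rewrite /spec sz => -[ext [pos [-> [h1 h2] h3]]]; split => //.
apply: (@le_trans _ _ (c + m * n * (3 * n + 40 * N + 100))%N%:R).
  by rewrite ler_nat.
pose ell : R := 1 + ln (m * n)%:R.
have m_ge1 : 1 <= m%:R :> R by rewrite ler1n.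
have n_ge1 : 1 <= n%:R :> R by rewrite ler1n.
have lm_ge0 := ln_nat_ge0 R m; have ln_ge0 := ln_nat_ge0 R n.
have eell : ell = 1 + ln m%:R + ln n%:R.
  by rewrite /ell natrM lnM ?posrE ?ltr0n // addrA.
have ell_ge1 : 1 <= ell ^+ 2 by rewrite exprn_ege1 // eell; lra.
pose b := mul_bound C1 omega k1 n.
have b_le : b <= C1 * n%:R `^ omega * ell ^+ k1.
  have C1_ge0 : 0 <= C1.
    have := (hinv 1%N isT).1; rewrite /mul_bound powR1 ln1 addr0 expr1n !mulr1.
    exact: le_trans.
  rewrite ler_wpM2l ?mulr_ge0 ?powR_ge0 //; apply: lerXn2r.
  - by rewrite nnegrE addr_ge0.
  - by rewrite nnegrE eell !addr_ge0.
  - by rewrite eell; lra.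
have q_ge0 : 0 <= (104 + 40 * `|K|) * ell ^+ 2.
  by rewrite mulr_ge0 ?sqr_ge0 // addr_ge0 ?mulr_ge0.
have -> : C1 * (104 + 40 * `|K|) * (m%:R * n%:R `^ omega) * (1 +
  ln (m * n)%:R) ^+ (k1 + 2) =
   C1 * n%:R `^ omega * ell ^+ k1 * (m%:R * ((104 + 40 * `|K|) * ell ^+ 2)).
  by rewrite exprD /ell; ring.
apply: (@le_trans _ _ (b * (m%:R * ((104 + 40 * `|K|) * ell ^+ 2))));
  last first.
  exact: ler_wpM2r (mulr_ge0 (ler0n _ _) q_ge0) _ _ b_le.
(* Here n^2 <= b converts the O~(m n^2) cost of the descent into m times the matrix multiplication
   bound. *)
have h4 : (m * n * (3 * n + 40 * N + 100))%N%:R <=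
    m%:R * (b * ((103 + 40 * `|K|) * ell ^+ 2)).
  rewrite natrM natrM -mulrA; apply: ler_pM => //.
  apply: (@le_trans _ _ (n%:R * n%:R * ((103 + 40 * `|K|) * ell ^+ 2))).
    rewrite -mulrA ler_wpM2l // 2!natrD 2!natrM.
    have h5 : N%:R <= `|K| * (n%:R * ell ^+ 2).
      apply: le_trans N_le _; rewrite -/ell -mulrA ler_wpM2r ?ler_norm //.
      by rewrite mulr_ge0 // sqr_ge0.
    have h6 : 1 <= n%:R * ell ^+ 2 by rewrite -[leLHS]mulr1; apply: ler_pM.
    have h7 : n%:R <= n%:R * ell ^+ 2 by rewrite ler_peMr.
    by lra.
  rewrite ler_wpM2r // -?natrM //.
  by rewrite mulr_ge0 ?sqr_ge0 // addr_ge0 ?mulr_ge0.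
have b_ge0 : 0 <= b by apply: le_trans n2_le.
have h8 : b <= b * (m%:R * ell ^+ 2).
  by rewrite ler_peMr // -[leLHS]mulr1; apply: ler_pM.
by rewrite natrD; have := c_le; rewrite -/b; lra.
Qed.
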